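(* Suppose that the solution set $\mathcal O$ of problem $(\mathbf P)$ is nonempty. Let $r>0$, let $\kappa_\gamma\ge 0$ be a modulus such that $$\mathrm{dist}(x,\mathcal O)\le \kappa_\gamma\,\mathrm{dist}(0,\partial\Gamma(x))\qquad\text{for all }x\in\mathbb R^t\text{ with }\mathrm{dist}(x,\mathcal O)\le r,$$ and suppose the initial point $x^0\in\mathbb R^t$ satisfies $\mathrm{dist}(x^0,\mathcal O)\le r-\alpha_\epsilon$, where $\alpha_\epsilon$ is the bound in criterion (A) of the context. Let $\{(Y^k,z^k,x^k)\}$ be any infinite sequence generated by the inexact augmented Lagrangian method (defined in the context) satisfying the stopping criteria (A) and (S1). Then the sequence $\{x^k\}$ converges to an optimal solution $x^*\in\mathcal O$, and for all $k\ge 0$, $$\mathrm{dist}(x^{k+1},\mathcal O)\le \zeta_k\,\mathrm{dist}(x^k,\mathcal O),$$ where $$\zeta_k=\bigl(\kappa_\gamma(\theta_k+1)(\kappa_\gamma^2+\sigma_k^2)^{-1/2}+\theta_k\bigr)(1-\theta_k)^{-1},\qquad \zeta_k\to\zeta_\infty=\kappa_\gamma(\kappa_\gamma^2+\sigma_\infty^2)^{-1/2}<1\ \text{ as }k\to\infty.$$ In addition, the sequence $\{(Y^k,z^k)\}$ converges to the unique optimal solution $(Y^*,z^* )$ of $(\mathbf D)$. Furthermore, if the stopping criterion (S2) is also satisfied, then, with $\kappa_l\ge 0$ some modulus for which the operator $\mathcal T_{\mathcal L}$ satisfies the error bound property described in the context, for all $k\ge 0$, $$\|(Y^{k+1},z^{k+1})-(Y^*,z^*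 )\|\le \zeta_k'\,\|x^{k+1}-x^k\|,$$ where $\zeta_k'=\kappa_l(1+\theta_k')/\sigma_k$ and $\zeta_k'\to\zeta'_\infty=\kappa_l/\sigma_\infty$ as $k\to\infty$.
   Context: Norms and inner products are Frobenius/Euclidean; $\circ$ is the componentwise product; $\mathrm{dist}(y,C)=\inf_{y'\in C}\|y-y'\|$, equal to $+\infty$ if $C=\emptyset$. $\mathbb S^p$ is the space of real symmetric $p\times p$ matrices. If $\sigma_\infty=+\infty$, the limits $\zeta_\infty$ and $\zeta'_\infty$ are read as $0$. Data: $A\in\mathbb R^{p\times n}$ has rank $n$, $\lambda>0$, and $I\subseteq\{1,\dots,p\}^2$ is a symmetric index set containing all diagonal pairs $(i,i)$; $\bar I$ is its complement and $t=(|I|+p)/2$ is the number of pairs $(i,j)\in I$ with $i\le j$. Operators: $L:\mathbb S^p\to\mathbb R^t$ maps $\Omega$ to the vector of its upper triangular entries (diagonal included) $\Omega_{ij}$ with $i\le j$, $(i,j)\in I$ (in a fixed order). $L^\dagger:\mathbb R^t\to\mathbb S^p$ maps $\omega$ to the symmetric matrix $\Omega$ with $\Omega_{ij}=0$ for $(i,j)\in\bar I$ and $L(\Omega)=\omega$. Let $I_p$ be the identity matrix, $E$ the all-ones $p\times p$ matrix, $e_1=L(I_p)$, $e_2=2L(E-I_p)$, $e_3=e_1+e_2/4$. The adjoint of $L$ is $L^*(v)=L^\dagger(v\circ e_3)$. Define $S:\mathbb R^{p\times n}\to\mathbb R^t$ by $S(Y)=\frac12L(YA^T+AY^T)$; its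 adjoint is $S^*(v)=L^*(v)A$. Problems: $$(\mathbf P)\quad \max_{x\in\mathbb R^t}\{-\Gamma(x)\},\qquad \Gamma(x)=\tfrac12\|S^*(x)\|_F^2-\langle x,e_1\rangle+\tfrac{\lambda}{2}\|x\circ e_2\|_1,$$ $$(\mathbf D)\quad \min_{Y\in\mathbb R^{p\times n},\,z\in\mathbb R^t}\Bigl\{\tfrac12\|Y\|_F^2+\delta_{b_\lambda}(z)\ \Big|\ S(Y)+z=e_1\Bigr\},$$ where $\delta_{b_\lambda}$ is the indicator function of $b_\lambda=\{z\in\mathbb R^t: e_1\circ z=0,\ |z_i|\le\lambda,\ i=1,\dots,t\}$. The solution set of $(\mathbf P)$ is $\mathcal O=(\partial\Gamma)^{-1}(0)$. Lagrangian: $\mathcal L(Y,z,x)=\frac12\|Y\|_F^2+\delta_{b_\lambda}(z)-\langle S(Y)+z-e_1,x\rangle$; augmented Lagrangian, for $\sigma>0$: $\mathcal L_\sigma(Y,z;x)=\mathcal L(Y,z,x)+\frac\sigma2\|S(Y)+z-e_1\|^2$. Operator $\mathcal T_{\mathcal L}(Y,z,x)=\{(Y',z',x') : (Y',z',-x')\in\partial\mathcal L(Y,z,x)\}$. The error bound property with modulus $\kappa_l$: for a radius $r_l>0$, $\mathrm{dist}(w,\mathcal T_{\mathcal L}^{-1}(0))\le\kappa_l\,\mathrm{dist}(0,\mathcal T_{\mathcal L}(w))$ for all $w=(Y,z,x)$ in the domain with $\mathrm{dist}(w,\mathcal T_{\mathcal L}^{-1}(0))\le r_l$. Inexact augmented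 Lagrangian method: given $\sigma_0>0$ and an initial point $(Y^0,z^0,x^0)\in\mathbb R^{p\times n}\times\mathbb R^t\times\mathbb R^t$, for $k=0,1,2,\dots$: (1) compute $(Y^{k+1},z^{k+1})$ as an approximate minimizer of $\Psi_k(Y,z):=\mathcal L_{\sigma_k}(Y,z;x^k)$; (2) set $x^{k+1}=x^k-\sigma_k(S(Y^{k+1})+z^{k+1}-e_1)$; (3) update $\sigma_{k+1}\uparrow\sigma_\infty\le+\infty$ (a nondecreasing sequence with limit $\sigma_\infty$). Stopping criteria for step (1): (A) $\Psi_k(Y^{k+1},z^{k+1})-\inf\Psi_k\le\epsilon_k^2/(2\sigma_k)$, $\sum_{k=0}^\infty\epsilon_k\le\alpha_\epsilon<\infty$. (S1) $\Psi_k(Y^{k+1},z^{k+1})-\inf\Psi_k\le(\theta_k^2/(2\sigma_k))\|x^{k+1}-x^k\|^2$, $\sum_{k=0}^\infty\theta_k<+\infty$. (S2) $\mathrm{dist}(0,\partial\Psi_k(Y^{k+1},z^{k+1}))\le(\theta'_k/\sigma_k)\|x^{k+1}-x^k\|$, $0\le\theta'_k\to0$.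
   Formalization: ε_k, θ_k ≥ 0 are assumed; the rate with ζ_k is stated for k with θ_k < 1; the bound with ζ'_k holds for all k if r_l is large enough (depending on the run), otherwise for k whose iterate is within r_l of T_L^{-1}(0) and for all large k. *)

(* Defs.v *)
From HB Require Import structures.
From mathcomp Require Import all_boot all_order all_algebra.
From mathcomp Require Import all_classical all_reals all_analysis.
From mathcomp Require Import lra.
Set Implicit Arguments.
Unset Strict Implicit.
Unset Printing Implicit Defensive.
Import Order.TTheory GRing.Theory Num.Theory.
Import numFieldNormedType.Exports.
Local Open Scope classical_set_scope.
Local Open Scope ring_scope.

(* The Euclidean structures are carried by explicit inner products because the
   norm that the library puts on matrices and on pairs is the sup norm; the
   topologies agree, so convergence of sequences is the library's. *)
Section Euclid.
Variable R : realType.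

Definition dotF m n (M N : 'M[R]_(m, n)) : R := \sum_i \sum_j M i j * N i j.

Definition dotX (U V : Type) (dU : U -> U -> R) (dV : V -> V -> R)
  (u v : U * V) : R := dU u.1 v.1 + dV u.2 v.2.

Definition enorm (V : Type) (dot : V -> V -> R) (v : V) : R :=
  Num.sqrt (dot v v).

Definition normF m n (M : 'M[R]_(m, n)) : R := enorm (@dotF m n) M.

Definition dist (V : zmodType) (dot : V -> V -> R) (y : V) (C : set V) : \bar R :=
  ereal_inf [set (enorm dot (y - y'))%:E | y' in C].

Definition subdiff (V : lmodType R) (dot : V -> V -> R) (f : V -> \bar R)
    (x : V) : set V :=
  [set v | f x \is a fin_num /\
           forall x', (f x + (dot v (x' - x))%:E <= f x')%E].

Definition superdiff (V : lmodType R) (dot : V -> V -> R) (f : V -> \bar R)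
    (x : V) : set V :=
  [set v | f x \is a fin_num /\
           forall x', (f x' <= f x + (dot v (x' - x))%:E)%E].

Definition indicator (V : Type) (C : set V) (z : V) : \bar R :=
  (if z \in C then 0 else +oo)%E.

Definition hadamard m n (u v : 'M[R]_(m, n)) : 'M[R]_(m, n) := map2_mx *%R u v.

Definition norm1 t (u : 'cV[R]_t) : R := \sum_i `|u i 0|.

(* limit of kappa (kappa^2 + s^2)^(-1/2), and of kappa / s, as s tends to a
   positive extended real *)
Definition zeta_inf (kappa : R) (s : \bar R) : R :=
  if s is s'%:E then kappa * (Num.sqrt (kappa ^+ 2 + s' ^+ 2))^-1 else 0.

Definition zeta'_inf (kappa : R) (s : \bar R) : R :=
  if s is s'%:E then kappa / s' else 0.

Definition zeta (kappa theta sigma : R) : R :=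
  (kappa * (theta + 1) * (Num.sqrt (kappa ^+ 2 + sigma ^+ 2))^-1 + theta)
  * (1 - theta)^-1.

Definition zeta' (kappa theta' sigma : R) : R := kappa * (1 + theta') / sigma.

End Euclid.

Section UpperIndex.
Variables (p : nat) (I : {set 'I_p * 'I_p}).

Definition symmetric_index := forall i j, ((i, j) \in I) = ((j, i) \in I).

Definition diag_index := forall i, (i, i) \in I.

Definition upper : {set 'I_p * 'I_p} :=
  [set ij in I | (ij.1 <= ij.2)%N]%SET.

Definition tdim : nat := #|upper|.

(* position (i, j), with i <= j, of the k-th coordinate of R^t *)
Definition upos (k : 'I_tdim) : 'I_p * 'I_p := enum_val k.

Lemma upos_inj : injective upos. Proof. exact: enum_val_inj. Qed.

Lemma upos_upper k : upos k \in upper. Proof. exact: enum_valP. Qed.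

Lemma tdimE : symmetric_index -> diag_index -> tdim = ((#|I| + p)./2)%N.
Proof.
move=> sI dI.
pose sw (ij : 'I_p * 'I_p) := (ij.2, ij.1).
have sw_inj : injective sw by move=> [a b] [c d] [-> ->].
pose dg (i : 'I_p) := (i, i).
have dg_inj : injective dg by move=> i j [].
have UI : (upper :|: (sw @: upper) = I)%SET.
  apply/setP => -[a b]; rewrite !inE /=; apply/orP/idP => [[/andP[]//|]|abI].
    by move=> /imsetP[[c d]]; rewrite !inE /= => /andP[cdI _] [-> ->]; rewrite sI.
  have [ab|/ltnW ba] := leqP a b; first by left; rewrite abI.
  by right; apply/imsetP; exists (b, a); rewrite ?inE //= sI abI.
have DI : (upper :&: (sw @: upper) = dg @: [set: 'I_p])%SET.
  apply/setP => -[a b]; rewrite !inE /=; apply/andP/imsetP => [[/andP[abI ab]]|].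
    move=> /imsetP[[c d]]; rewrite !inE /= => /andP[_ cd] [ac bd].
    exists a; rewrite ?inE // /dg; congr (_, _); apply/val_inj/anti_leq.
    by rewrite ab /= ac bd cd.
  move=> [c _ [-> ->]]; rewrite dI leqnn; split=> //.
  by apply/imsetP; exists (c, c); rewrite ?inE //= dI leqnn.
have := cardsUI upper (sw @: upper)%SET.
by rewrite UI DI !card_imset // cardsT card_ord => ->; rewrite addnn doubleK.
Qed.

End UpperIndex.

Section Problem.
Variables (R : realType) (p n : nat) (A : 'M[R]_(p, n)) (lam : R).
Variable I : {set 'I_p * 'I_p}.

Local Notation t := (tdim I).
Local Notation vec := 'cV[R]_t.
Local Notation mat := 'M[R]_(p, n).

Definition Lop (Om : 'M[R]_p) : vec := \col_k Om (upos k).1 (upos k).2.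

(* for (i, j) in I exactly one k satisfies the condition, otherwise none does *)
Definition Ldag (w : vec) : 'M[R]_p :=
  \matrix_(i, j)
    \sum_(k < t | (upos k == (i, j)) || (upos k == (j, i))) w k 0.

Lemma Ldag_sym w : (Ldag w)^T = Ldag w.
Proof. by apply/matrixP => i j; rewrite !mxE; apply: eq_bigl => k; rewrite orbC. Qed.

Lemma Ldag_notin w i j : symmetric_index I -> (i, j) \notin I -> Ldag w i j = 0.
Proof.
move=> sI ijI; rewrite mxE big1 // => k kij.
have := upos_upper k; rewrite inE => /andP[kI _].
by case/orP: kij => /eqP ke; rewrite ke ?(sI j i) (negPf ijI) in kI.
Qed.

Lemma LdagK w : Lop (Ldag w) = w.
Proof.
apply/matrixP => k c; rewrite ord1 !mxE -surjective_pairing (bigD1 k) ?eqxx //=.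
rewrite big1 ?addr0 // => l /andP[/orP[/eqP/upos_inj -> |/eqP le]].
  by rewrite eqxx.
have := upos_upper l; have := upos_upper k; rewrite !inE le /=.
move=> /andP[_ k12] /andP[_ k21] /eqP[]; apply: upos_inj.
rewrite le [RHS]surjective_pairing.
by congr (_, _); apply/val_inj/anti_leq; rewrite /= k12 k21.
Qed.

Definition e1 : vec := Lop 1%:M.
Definition e2 : vec := 2 *: Lop (const_mx 1 - 1%:M).
Definition e3 : vec := e1 + 4^-1 *: e2.

Definition Ladj (v : vec) : 'M[R]_p := Ldag (hadamard v e3).

Definition Sop (Y : mat) : vec := 2^-1 *: Lop (Y *m A^T + A *m Y^T).

Definition Sadj (v : vec) : mat := Ladj v *m A.

Lemma dotF_Lop Om v : Om^T = Om -> dotF (Lop Om) v = dotF Om (Ladj v).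
Proof.
move=> sOm.
rewrite /dotF [RHS]pair_big /=.
transitivity (\sum_(ij : 'I_p * 'I_p)
    \sum_(k < t | (upos k == ij) || (upos k == (ij.2, ij.1)))
      Om ij.1 ij.2 * (hadamard v e3) k 0); last first.
  by apply: eq_bigr => -[i j] _; rewrite mxE mulr_sumr.
rewrite [RHS](exchange_big_dep predT) //=.
apply: eq_bigr => k _.
rewrite big_ord1 -mulr_suml !mxE.
rewrite (bigD1 (upos k)) ?eqxx //=.
have [d|nd] := eqVneq (upos k).1 (upos k).2.
  rewrite big1 ?addr0 => [|[i j]]; last first.
    case/andP=> /orP[/eqP <-|/eqP ke]; first by rewrite eqxx.
    by move: d; rewrite ke /= => ->; rewrite eqxx.
  by rewrite subrr !mulr0 addr0 mulr1.
rewrite (bigD1 ((upos k).2, (upos k).1)) /=; last first.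
  rewrite -surjective_pairing eqxx orbT /=.
  by apply: contra nd => /eqP/(congr1 fst) /= ->; rewrite eqxx.
rewrite big1 ?addr0 => [|[i j]]; last first.
  by case/andP=> /andP[/orP[/eqP <-|/eqP ->]]; rewrite ?eqxx.
have -> : Om (upos k).2 (upos k).1 = Om (upos k).1 (upos k).2.
  by rewrite -{1}sOm mxE.
rewrite ?mulr0n; lra.
Qed.

Lemma dotF_Sop Y v : dotF (Sop Y) v = dotF Y (Sadj v).
Proof.
have dotE m q (M N : 'M[R]_(m, q)) : dotF M N = \tr (M *m N^T).
  by apply: eq_bigr => i _; rewrite mxE; apply: eq_bigr => j _; rewrite !mxE.
have -> : dotF (Sop Y) v = 2^-1 * dotF (Lop (Y *m A^T + A *m Y^T)) v.
  rewrite /dotF mulr_sumr; apply: eq_bigr => i _.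
  by rewrite mulr_sumr; apply: eq_bigr => j _; rewrite mxE mulrA.
rewrite dotF_Lop; last by rewrite linearD /= !trmx_mul !trmxK addrC.
rewrite !dotE /Sadj trmx_mul Ldag_sym mulmxDl linearD /= mulmxA.
have -> : \tr (A *m Y^T *m Ladj v) = \tr (Y *m A^T *m Ladj v).
  rewrite -mxtrace_tr !trmx_mul trmxK Ldag_sym mxtrace_mulC //.
by lra.
Qed.

Definition Gam (x : vec) : R :=
  2^-1 * normF (Sadj x) ^+ 2 - dotF x e1 + lam / 2 * norm1 (hadamard x e2).

Definition dGam : vec -> set vec := subdiff (@dotF R t 1) (fun x => (Gam x)%:E).

(* the solution set of (P), i.e. the inverse image of 0 under dGam *)
Definition sol_primal : set vec := [set x | dGam x 0].

Definition blam : set vec :=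
  [set z | hadamard e1 z = 0 /\ forall i, `|z i 0| <= lam].

Definition objD (yz : mat * vec) : \bar R :=
  ((2^-1 * normF yz.1 ^+ 2)%:E + indicator R blam yz.2)%E.

Definition feasD : set (mat * vec) := [set yz | Sop yz.1 + yz.2 = e1].

Definition sol_dual : set (mat * vec) :=
  [set yz | [/\ feasD yz, (objD yz < +oo)%E &
                forall yz', feasD yz' -> (objD yz <= objD yz')%E]].

Definition dotYZ : mat * vec -> mat * vec -> R := dotX (@dotF R p n) (@dotF R t 1).

Definition dotYZX : mat * vec * vec -> mat * vec * vec -> R :=
  dotX dotYZ (@dotF R t 1).

Definition Lagr (yz : mat * vec) (x : vec) : \bar R :=
  (objD yz - (dotF (Sop yz.1 + yz.2 - e1) x)%:E)%E.

Definition augLagr (sigma : R) (yz : mat * vec) (x : vec) : \bar R :=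
  (Lagr yz x + (sigma / 2 * normF (Sop yz.1 + yz.2 - e1) ^+ 2)%:E)%E.

(* Lagr is convex in (Y, z) and concave in x: its subdifferential is the
   product of the partial subdifferential in (Y, z) and of the partial
   superdifferential in x. *)
Definition dLagr (w : mat * vec * vec) : set (mat * vec * vec) :=
  [set v | subdiff dotYZ (fun yz => Lagr yz w.2) w.1 v.1 /\
           superdiff (@dotF R t 1) (fun x => Lagr w.1 x) w.2 v.2].

Definition TL (w : mat * vec * vec) : set (mat * vec * vec) :=
  [set v | dLagr w (v.1, - v.2)].

Definition zerosTL : set (mat * vec * vec) := [set w | TL w 0].

Definition error_bound_TL (rl kappal : R) : Prop :=
  forall w, TL w !=set0 -> (dist dotYZX w zerosTL <= rl%:E)%E ->
    (dist dotYZX w zerosTL <= kappal%:E * dist dotYZX 0 (TL w))%E.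

Definition error_bound_dGam (r kappa : R) : Prop :=
  forall x, (dist (@dotF R t 1) x sol_primal <= r%:E)%E ->
    (dist (@dotF R t 1) x sol_primal <= kappa%:E * dist (@dotF R t 1) 0 (dGam x))%E.

(* The iterates of the inexact augmented Lagrangian method; the accuracy of the
   approximate minimizations is left to the stopping criteria. *)
Definition ialm (sigma : nat -> R) (sigmaoo : \bar R)
    (Y : nat -> mat) (z x : nat -> vec) : Prop :=
  [/\ 0 < sigma 0%N,
      nondecreasing_seq sigma,
      (sigma k)%:E @[k --> \oo] --> sigmaoo &
      forall k, x k.+1 = x k - sigma k *: (Sop (Y k.+1) + z k.+1 - e1)].

Section Criteria.
Variables (sigma : nat -> R) (Y : nat -> mat) (z x : nat -> vec).

Definition Psi (k : nat) (yz : mat * vec) : \bar R := augLagr (sigma k) yz (x k).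

Definition gapPsi (k : nat) : \bar R :=
  (Psi k (Y k.+1, z k.+1) - ereal_inf (range (Psi k)))%E.

Definition critA (eps : nat -> R) (alpha : R) : Prop :=
  [/\ forall k, 0 <= eps k,
      forall k, (gapPsi k <= (eps k ^+ 2 / (2 * sigma k))%:E)%E &
      (\sum_(0 <= k <oo) (eps k)%:E <= alpha%:E)%E].

Definition critS1 (theta : nat -> R) : Prop :=
  [/\ forall k, 0 <= theta k,
      forall k, (gapPsi k <= (theta k ^+ 2 / (2 * sigma k)
                              * normF (x k.+1 - x k) ^+ 2)%:E)%E &
      (\sum_(0 <= k <oo) (theta k)%:E < +oo)%E].

Definition critS2 (theta' : nat -> R) : Prop :=
  [/\ forall k, 0 <= theta' k,
      forall k, (dist dotYZ 0 (subdiff dotYZ (Psi k) (Y k.+1, z k.+1))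
                 <= (theta' k / sigma k * normF (x k.+1 - x k))%:E)%E &
      theta' @ \oo --> 0].

End Criteria.

End Problem.

Arguments dotYZ {R} p n I u v.
Arguments dotYZX {R} p n I u v.
Arguments sol_primal {R p n} A lam I _.
Arguments sol_dual {R p n} A lam I _.
Arguments zerosTL {R p n} A lam I _.
Arguments error_bound_TL {R p n} A lam I rl kappal.
Arguments error_bound_dGam {R p n} A lam I r kappa.

(* Main.v *)
(** For a multiplier x and a step s, the augmented Lagrangian is the Moreau
    envelope, in the dual variable, of the Lagrangian; hence an iterate whose
    optimality gap is g satisfies |x^(k+1) - prox x^k|^2 <= 2 s g, where prox is
    the proximal map of s Gam.  The method is therefore an inexact proximal point
    method for (P): criterion (A) gives quasi-Fejer monotonicity with respect to
    the solution set, and the error bound at prox x^k combined with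
    |prox x - o|^2 + |x - prox x|^2 <= |x - o|^2 (o a solution) gives the linear
    rate.  Vanishing distance and quasi-Fejer monotonicity make (x^k) Cauchy.
    For the dual, strong convexity of |Y|^2 / 2 bounds |Y^(k+1) - Y*|^2 by the
    residual and the gap.  For the last estimate, a subgradient of Psi_k at
    (Y^(k+1), z^(k+1)) together with the residual (x^k - x^(k+1)) / sigma_k is an
    element of T_L at the new iterate. *)

Require Import Defs.
From HB Require Import structures.
From mathcomp Require Import all_boot all_order all_algebra.
From mathcomp Require Import all_classical all_reals all_analysis.
From mathcomp Require Import ring lra.
Set Implicit Arguments.
Unset Strict Implicit.
Unset Printing Implicit Defensive.
Import Order.TTheory GRing.Theory Num.Theory.
Import numFieldNormedType.Exports.
Local Open Scope classical_set_scope.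
Local Open Scope ring_scope.

(** * Inner products, distances, inexact proximal points *)

(** A predicate on [dot], so that the same lemmas apply to matrices and to nested pairs. *)
Record inner_product {R : realType} {V : lmodType R} (dot : V -> V -> R) : Prop := {
  ipC : forall u v, dot u v = dot v u;
  ipDl : forall u v w, dot (u + v) w = dot u w + dot v w;
  ipZl : forall a u v, dot (a *: u) v = a * dot u v;
  ip_ge0 : forall u, 0 <= dot u u;
  ip_eq0 : forall u, dot u u = 0 -> u = 0 }.
Arguments ipC {R V dot}.
Arguments ipDl {R V dot}.
Arguments ipZl {R V dot}.
Arguments ip_ge0 {R V dot}.
Arguments ip_eq0 {R V dot}.

Section InnerProduct.
Context {R : realType} {V : lmodType R} {dot : V -> V -> R}.
Hypothesis ip : inner_product dot.
Local Notation norm := (enorm dot).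

Lemma ipDr u v w : dot u (v + w) = dot u v + dot u w.
Proof. by rewrite (ipC ip) (ipDl ip) !(ipC ip u). Qed.

Lemma ipZr a u v : dot u (a *: v) = a * dot u v.
Proof. by rewrite (ipC ip) (ipZl ip) (ipC ip u). Qed.

Lemma ipNl u v : dot (- u) v = - dot u v.
Proof. by rewrite -scaleN1r (ipZl ip) mulN1r. Qed.

Lemma ipNr u v : dot u (- v) = - dot u v.
Proof. by rewrite -scaleN1r ipZr mulN1r. Qed.

Lemma ip0l v : dot 0 v = 0.
Proof. by rewrite -(scale0r 0) (ipZl ip) mul0r. Qed.

Lemma ip0r v : dot v 0 = 0.
Proof. by rewrite (ipC ip) ip0l. Qed.

Definition ipE := (ipDr, (ipDl ip), ipZr, (ipZl ip), ipNl, ipNr).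

Lemma sqr_enorm u : norm u ^+ 2 = dot u u.
Proof. by rewrite sqr_sqrtr// ip_ge0. Qed.

Lemma enorm_ge0 u : 0 <= norm u.
Proof. exact: sqrtr_ge0. Qed.

Lemma enorm_eq0 u : norm u = 0 -> u = 0.
Proof. by move=> u0; apply: (ip_eq0 ip); rewrite -sqr_enorm u0 expr0n. Qed.

Lemma enormN u : norm (- u) = norm u.
Proof. by rewrite /enorm ipNl ipNr opprK. Qed.

Lemma enormBC u v : norm (u - v) = norm (v - u).
Proof. by rewrite -enormN opprB. Qed.

Lemma enormZ a u : norm (a *: u) = `|a| * norm u.
Proof.
by rewrite /enorm ipZr (ipZl ip) mulrA sqrtrM ?sqr_ge0// -expr2 sqrtr_sqr.
Qed.

Lemma cauchy_schwarz u v : dot u v <= norm u * norm v.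
Proof.
have [nu0|nu0] := eqVneq (norm u) 0.
  by rewrite nu0 (enorm_eq0 nu0) ip0l mul0r.
have [nv0|nv0] := eqVneq (norm v) 0.
  by rewrite nv0 (enorm_eq0 nv0) ip0r mulr0.
have upos : 0 < norm u by rewrite lt_neqAle eq_sym nu0 enorm_ge0.
have vpos : 0 < norm v by rewrite lt_neqAle eq_sym nv0 enorm_ge0.
(* Expanding this square gives 2 |u| |v| (|u| |v| - <u, v>). *)
have := ip_ge0 ip (norm v *: u - norm u *: v).
rewrite !ipE (ipC ip v u) -!sqr_enorm => h.
have {}h : 0 <= (2 * (norm u * norm v)) * (norm u * norm v - dot u v) by lra.
by rewrite -subr_ge0; move: h; rewrite pmulr_rge0// mulr_gt0// mulr_gt0.
Qed.

Lemma cauchy_schwarz_abs u v : `|dot u v| <= norm u * norm v.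
Proof.
rewrite ler_norml cauchy_schwarz andbT lerNl -ipNl -(enormN u).
exact: cauchy_schwarz.
Qed.

Lemma ler_enormD u v : norm (u + v) <= norm u + norm v.
Proof.
rewrite -(@ler_pXn2r _ 2) ?nnegrE ?addr_ge0 ?enorm_ge0//.
rewrite sqrrD !sqr_enorm !ipE (ipC ip v u).
have := cauchy_schwarz u v; lra.
Qed.

Lemma ler_enormB u v w : norm (u - v) <= norm (u - w) + norm (w - v).
Proof. by rewrite -[in norm (u - v)](subrKA w) ler_enormD. Qed.

End InnerProduct.

Section Dist.
Context {R : realType} {V : lmodType R} {dot : V -> V -> R}.
Local Notation norm := (enorm dot).

Lemma dist_ge0 y (C : set V) : (0 <= dist dot y C)%E.
Proof. by apply: le_ereal_inf_tmp => _ [c _ <-]; rewrite lee_fin sqrtr_ge0. Qed.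

Lemma dist_le y (C : set V) c : C c -> (dist dot y C <= (norm (y - c))%:E)%E.
Proof. by move=> Cc; apply: ereal_inf_lbound; exists c. Qed.

Lemma dist_ltP y (C : set V) (d : R) :
  (dist dot y C < d%:E)%E -> exists2 c, C c & norm (y - c) < d.
Proof. by move=> /ereal_inf_lt[_ [c Cc <-]]; rewrite lte_fin; exists c. Qed.

Variables (C : set V).
Hypothesis C0 : C !=set0.

(** [fine] sends an infinite distance to 0, so this is the distance only for nonempty [C]. *)
Definition rdist y : R := fine (dist dot y C).

Lemma distE y : dist dot y C = (rdist y)%:E.
Proof.
rewrite /rdist fineK// ge0_fin_numE ?dist_ge0//.
by case: C0 => c /dist_le /le_lt_trans; apply; rewrite ltry.
Qed.

Lemma rdist_ge0 y : 0 <= rdist y.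
Proof. by rewrite fine_ge0// dist_ge0. Qed.

Lemma rdist_le y c : C c -> rdist y <= norm (y - c).
Proof. by move=> Cc; rewrite -lee_fin -distE dist_le. Qed.

(** The infimum may not be attained; near-minimizers with slack [e] stand in for projections
    throughout. *)
Lemma rdist_approx y e : 0 < e -> exists2 c, C c & norm (y - c) < rdist y + e.
Proof. by move=> e0; apply: dist_ltP; rewrite distE lte_fin ltrDl. Qed.

End Dist.
Arguments rdist {R V} dot C y.

(* Tests first-order conditions along a segment x + s (y - x), s -> 0. *)
Lemma segment_ge0 (R : realFieldType) (a b : R) :
  (forall s, 0 < s -> s <= 1 -> 0 <= s * a + s ^+ 2 * b) -> 0 <= a.
Proof.
move=> h; rewrite leNgt; apply/negP => a0.
have b0 : 0 <= `|b| by [].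
(* Small enough that s |b| <= -a / 2, whence a + s b <= a / 2 < 0. *)
pose s := - a / (2 * (`|b| - a)).
have den : 0 < 2 * (`|b| - a) by lra.
have s0 : 0 < s by rewrite divr_gt0// oppr_gt0.
have s1 : s <= 1 by rewrite ler_pdivrMr//; lra.
have sb : s * `|b| <= - a / 2.
  rewrite mulrAC ler_pdivrMr//.
  have : 0 <= a ^+ 2 by exact: sqr_ge0.
  lra.
have := h _ s0 s1; rewrite expr2 -mulrA -mulrDr pmulr_rge0// => {}h.
have : s * b <= s * `|b| by rewrite ler_pM2l// ler_norm.
lra.
Qed.

(** * Inexact proximal point iterations under an error bound *)

Section ProximalPoint.
Context {R : realType} {V : lmodType R} {dot : V -> V -> R}.
Hypothesis ip : inner_product dot.
Local Notation norm := (enorm dot).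
Variable f : V -> R.

Lemma subdiff_fin x v :
  subdiff dot (fun x => (f x)%:E) x v <->
  forall x', f x + dot v (x' - x) <= f x'.
Proof.
by split=> [[_ h] x'|h]; [have := h x'|split=> // x']; rewrite -EFinD lee_fin.
Qed.

Let df := subdiff dot (fun x => (f x)%:E).
Let O := [set x | df x 0].

(** Monotonicity of the subdifferential between [q] and [xb] gives <a - q, xb - q> <= 0, which signs
    the cross term in the expansion of |a - xb|^2. *)
Lemma sqr_prox_le s a q xb : 0 < s -> df q (s^-1 *: (a - q)) -> O xb ->
  norm (q - xb) ^+ 2 + norm (a - q) ^+ 2 <= norm (a - xb) ^+ 2.
Proof.
move=> s0 /subdiff_fin/(_ xb) h /subdiff_fin/(_ q); rewrite (ip0l ip) addr0 => h'.
have {h h'} : s^-1 * dot (a - q) (xb - q) <= 0 by rewrite -(ipZl ip); lra.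
rewrite pmulr_rle0 ?invr_gt0// => h.
rewrite !(sqr_enorm ip) -(subrKA q a (- xb)); move: h.
rewrite -(opprB q xb) (ipNr ip); move: (a - q) (q - xb) => u v.
by rewrite !(ipE ip) (ipC ip v u); lra.
Qed.

Variables (r kg alpha : R) (sigma eps : nat -> R) (x q : nat -> V).
Hypotheses (O0 : O !=set0) (kg_ge0 : 0 <= kg).
Hypothesis error_bound : forall x, (dist dot x O <= r%:E)%E ->
  (dist dot x O <= kg%:E * dist dot 0 (df x))%E.
Hypothesis x0_near : (dist dot (x 0%N) O <= (r - alpha)%:E)%E.
Hypothesis sigma_gt0 : forall k, 0 < sigma k.
Hypothesis proxq : forall k, df (q k) ((sigma k)^-1 *: (x k - q k)).
Hypotheses (eps_ge0 : forall k, 0 <= eps k)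
  (sum_eps : forall n, \sum_(0 <= k < n) eps k <= alpha)
  (xq_eps : forall k, norm (x k.+1 - q k) <= eps k).
Local Notation d := (rdist dot O).

Lemma prox_le k xb : O xb -> norm (q k - xb) <= norm (x k - xb).
Proof.
move=> Oxb; rewrite -(@ler_pXn2r _ 2) ?nnegrE ?enorm_ge0//.
by apply: le_trans (sqr_prox_le (sigma_gt0 k) (proxq k) Oxb); rewrite lerDl sqr_ge0.
Qed.

Lemma fejer_step k xb : O xb -> norm (x k.+1 - xb) <= norm (x k - xb) + eps k.
Proof.
move=> Oxb; apply: (le_trans (ler_enormB ip _ _ (q k))).
by rewrite addrC lerD// prox_le.
Qed.

Lemma fejer_sum m n xb : O xb -> (m <= n)%N ->
  norm (x n - xb) <= norm (x m - xb) + \sum_(m <= k < n) eps k.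
Proof.
move=> Oxb; elim: n => [|n IH].
  by rewrite leqn0 => /eqP ->; rewrite big_geq// addr0.
rewrite leq_eqVlt => /predU1P[->|mn]; first by rewrite big_geq// addr0.
rewrite big_nat_recr//= addrA; apply: (le_trans (fejer_step n Oxb)).
by rewrite lerD2r IH.
Qed.

(** The errors total at most [alpha], which the initial margin [r - alpha] absorbs; the error bound
    thus stays available along the whole iteration. *)
Lemma rdist_le_r k : d (x k) <= r.
Proof.
apply/ler_addgt0Pr => e e0.
have [xb Oxb xbe] := rdist_approx (dot := dot) O0 (x 0%N) e0.
apply: (le_trans (rdist_le O0 (x k) Oxb)).
apply: (le_trans (fejer_sum Oxb (leq0n k))).
move: x0_near; rewrite (distE O0) lee_fin => h.
have := sum_eps k; lra.
Qed.

Lemma rdist_prox_le k : d (q k) <= d (x k).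
Proof.
apply/ler_addgt0Pr => e e0.
have [xb Oxb xbe] := rdist_approx (dot := dot) O0 (x k) e0.
apply: (le_trans (rdist_le O0 (q k) Oxb)).
by apply: (le_trans (prox_le k Oxb)); exact: ltW.
Qed.

Lemma sqr_rdist_prox_le k : d (q k) ^+ 2 + norm (x k - q k) ^+ 2 <= d (x k) ^+ 2.
Proof.
(* Square roots are compared instead, so that the slack [e] of a near-projection enters
   additively. *)
rewrite -[leRHS]sqr_sqrtr ?sqr_ge0// -[leLHS]sqr_sqrtr ?addr_ge0 ?sqr_ge0//.
rewrite ler_pXn2r ?nnegrE ?sqrtr_ge0// [leRHS]sqrtr_sqr (ger0_norm (rdist_ge0 _ _)).
apply/ler_addgt0Pr => e e0.
have [xb Oxb xbe] := rdist_approx (dot := dot) O0 (x k) e0.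
apply: le_trans (ltW xbe).
rewrite -[leRHS](ger0_norm (enorm_ge0 _)) -sqrtr_sqr ler_wsqrtr//.
apply: le_trans (sqr_prox_le (sigma_gt0 k) (proxq k) Oxb).
by rewrite lerD2r ler_pXn2r ?nnegrE ?rdist_ge0 ?enorm_ge0 ?rdist_le.
Qed.

Lemma norm_prox_le k : norm (x k - q k) <= d (x k).
Proof.
rewrite -(@ler_pXn2r _ 2) ?nnegrE ?enorm_ge0 ?rdist_ge0//.
by apply: le_trans (sqr_rdist_prox_le k); rewrite lerDr sqr_ge0.
Qed.

(** The error bound at [q k], where (x k - q k) / sigma k is a subgradient, gives sigma d(q) <= kg
    |x - q|; squaring and inserting |x - q|^2 <= d(x)^2 - d(q)^2 yields the factor. *)
Lemma rdist_prox_contract k :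
  d (q k) <= kg * (Num.sqrt (kg ^+ 2 + sigma k ^+ 2))^-1 * d (x k).
Proof.
have s0 := sigma_gt0 k.
have den0 : 0 < kg ^+ 2 + sigma k ^+ 2 by rewrite ltr_wpDl ?sqr_ge0 ?exprn_gt0.
have : (d (q k) <= kg * ((sigma k)^-1 * norm (x k - q k))).
  have : (dist dot (q k) O <= r%:E)%E.
    by rewrite (distE O0) lee_fin (le_trans (rdist_prox_le k)) ?rdist_le_r.
  move=> /error_bound; rewrite (distE O0) -lee_fin => /le_trans; apply.
  rewrite EFinM lee_wpmul2l ?lee_fin//; apply: (le_trans (dist_le 0 (proxq k))).
  by rewrite lee_fin sub0r (enormN ip) (enormZ ip) gtr0_norm ?invr_gt0.
rewrite mulrCA ler_pdivlMl// => h1.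
have h2 := sqr_rdist_prox_le k.
rewrite mulrAC ler_pdivlMr ?sqrtr_gt0//.
rewrite -(@ler_pXn2r _ 2) ?nnegrE ?mulr_ge0 ?rdist_ge0 ?sqrtr_ge0//.
rewrite !exprMn sqr_sqrtr ?(ltW den0)//.
have h3 : (sigma k * d (q k)) ^+ 2 <= (kg * norm (x k - q k)) ^+ 2.
  by rewrite ler_pXn2r ?nnegrE ?mulr_ge0 ?rdist_ge0 ?enorm_ge0// ltW.
move: h3; rewrite !exprMn => h3.
have h4 : kg ^+ 2 * (d (q k) ^+ 2 + norm (x k - q k) ^+ 2) <= kg ^+ 2 * d (x k) ^+ 2.
  by rewrite ler_wpM2l ?sqr_ge0.
lra.
Qed.

(** The error is relative to the step from [x k] to [x k.+1]. Splitting that step at [q k] and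
    absorbing one part gives (1 - th) |x k.+1 - q k| <= th d(x k). *)
Lemma rdist_contract k th : 0 <= th -> th < 1 ->
  norm (x k.+1 - q k) <= th * norm (x k.+1 - x k) ->
  d (x k.+1) <= zeta kg th (sigma k) * d (x k).
Proof.
move=> th0 th1 h.
have h1 : norm (x k.+1 - q k) <= th * (norm (x k.+1 - q k) + norm (x k - q k)).
  by rewrite (le_trans h)// ler_wpM2l// (enormBC ip (x k)) ler_enormB.
have h2 := norm_prox_le k; have h3 := rdist_prox_contract k.
rewrite /zeta; set rho := kg * (Num.sqrt _)^-1 in h3 *.
have rho0 : 0 <= rho by rewrite mulr_ge0 ?invr_ge0 ?sqrtr_ge0.
have h4 : d (x k.+1) <= norm (x k.+1 - q k) + d (q k).
  apply/ler_addgt0Pr => e e0.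
  have [xb Oxb xbe] := rdist_approx (dot := dot) O0 (q k) e0.
  apply: (le_trans (rdist_le O0 (x k.+1) Oxb)).
  by rewrite (le_trans (ler_enormB ip _ _ (q k)))// -addrA lerD2l ltW.
have d0 : 0 <= d (x k) by exact: rdist_ge0.
have rd0 : 0 <= rho * d (x k) by rewrite mulr_ge0.
have h5 : (1 - th) * norm (x k.+1 - q k) <= th * d (x k).
  have : th * norm (x k - q k) <= th * d (x k) by rewrite ler_wpM2l.
  by move: h1; rewrite mulrDr; lra.
rewrite mulrAC ler_pdivlMr ?subr_gt0// (mulrAC kg).
have h6 : d (x k.+1) * (1 - th) <= (norm (x k.+1 - q k) + rho * d (x k)) * (1 - th).
  by rewrite ler_wpM2r ?subr_ge0 ?(ltW th1)// (le_trans h4)// lerD2l.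
(* The estimates give the numerator th + rho (1 - th); the [theta + 1] of [zeta] leaves a surplus 2
   th rho. *)
rewrite -/rho; have : 0 <= th * (rho * d (x k)) by rewrite mulr_ge0.
move: h6 h5; lra.
Qed.

(** Once d(x m) and the remaining errors are below e / 4, a single solution [xb] stays within e / 2
    of all later iterates. *)
Lemma fejer_cauchy :
  (forall e, 0 < e -> \forall k \near \oo, d (x k) < e) ->
  (forall e, 0 < e -> exists N, forall m n, (N <= m)%N -> (m <= n)%N ->
     \sum_(m <= k < n) eps k < e) ->
  forall e, 0 < e -> exists N, forall i j, (N <= i)%N -> (N <= j)%N ->
    norm (x i - x j) < e.
Proof.
move=> d0 tail e e0.
have e4 : 0 < e / 4 by lra.
have [N hN] := tail _ e4; have [M _ hM] := d0 _ e4.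
pose m := maxn N M.
have dme : 0 < e / 4 - d (x m).
  by rewrite subr_gt0; apply: hM; rewrite /= leq_maxr.
have [xb Oxb xbe] := rdist_approx (dot := dot) O0 (x m) dme.
have near n : (m <= n)%N -> norm (x n - xb) < e / 2.
  by move=> mn; have := fejer_sum Oxb mn; have := hN _ _ (leq_maxl N M) mn; lra.
exists m => i j mi mj; apply: (le_lt_trans (ler_enormB ip _ _ xb)).
by rewrite (enormBC ip xb); have := near _ mi; have := near _ mj; lra.
Qed.

End ProximalPoint.

Definition enorm_cauchy {R : realType} {V : lmodType R} (dot : V -> V -> R)
  (x : nat -> V) := forall e, 0 < e -> exists N, forall i j,
  (N <= i)%N -> (N <= j)%N -> enorm dot (x i - x j) < e.

(** * Existence of proximal points *)

Section ProxExistence.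
Context {R : realType} {V : lmodType R} {dot : V -> V -> R}.
Hypothesis ip : inner_product dot.
Local Notation norm := (enorm dot).
Hypothesis complete : forall x : nat -> V, enorm_cauchy dot x ->
  exists l, norm (x k - l) @[k --> \oo] --> 0.
Variable f : V -> R.
Local Notation df := (subdiff dot (fun x => (f x)%:E)).
(* A subgradient at every point encodes convexity and lower semicontinuity. *)
Hypothesis df_neq0 : forall x, df x !=set0.

(** A subgradient at the intermediate point is tested at both ends; its contributions cancel in the
    weighted sum. *)
Lemma subdiff_convex x y s : 0 <= s -> s <= 1 ->
  f (x + s *: (y - x)) <= (1 - s) * f x + s * f y.
Proof.
move=> s0 s1; have [g /subdiff_fin h] := df_neq0 (x + s *: (y - x)).
have := h x; rewrite opprD addNKr (ipNr ip) (ipZr ip) => hx.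
have := h y; rewrite opprD addrA -[X in dot g (X - _)]scale1r -scalerBl.
  rewrite (ipZr ip) => hy.
have h1 : (1 - s) * (f (x + s *: (y - x)) + - (s * dot g (y - x))) <= (1 - s) * f x.
  by rewrite ler_wpM2l// subr_ge0.
have h2 : s * (f (x + s *: (y - x)) + (1 - s) * dot g (y - x)) <= s * f y.
  by rewrite ler_wpM2l.
lra.
Qed.

(** A subgradient [g] at [y] bounds f(y) by f(xb) + |g| |y - xb|, and f(xb) is the minimum for every
    minimizer [xb]. *)
Lemma subdiff_closed y :
  (forall e, 0 < e -> exists2 xb, df xb 0 & norm (y - xb) < e) ->
  df y 0.
Proof.
move=> h; apply/subdiff_fin => x; rewrite (ip0l ip) addr0.
have [g /subdiff_fin hg] := df_neq0 y.
apply/ler_addgt0Pr => e e0.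
have ng : 0 < norm g + 1 by rewrite ltr_wpDl ?enorm_ge0.
have [|xb /subdiff_fin/(_ x) + yxb] := h (e / (norm g + 1)).
  by rewrite divr_gt0.
rewrite (ip0l ip) addr0 => fxb.
have := hg xb; rewrite -(opprB y) (ipNr ip) => h1.
have h2 := cauchy_schwarz ip g (y - xb).
have h3 : norm g * norm (y - xb) <= e.
  apply: (@le_trans _ _ ((norm g + 1) * (e / (norm g + 1)))).
    by rewrite ler_pM ?enorm_ge0 ?lerDl ?ltW.
  by rewrite mulrC divfK ?gt_eqF.
lra.
Qed.

Lemma prox_exists (m s : R) (a : V) : 0 < s -> (forall x, m <= f x) ->
  exists q, df q (s^-1 *: (a - q)).
Proof.
move=> s0 fm.
pose F x := f x + (2 * s)^-1 * dot (x - a) (x - a).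
have is0 : 0 < (2 * s)^-1 by rewrite invr_gt0 mulr_gt0.
have FE x : F x = f x + (2 * s)^-1 * dot (x - a) (x - a) by [].
have Fm x : m <= F x by rewrite ler_wpDr// mulr_ge0 ?(ip_ge0 ip)// ltW.
pose M := inf (range F).
have hasinf : has_inf (range F).
  by split; [exists (F 0), 0|exists m => _ [x _ <-]].
have MF x : M <= F x by apply: ge_inf; [case: hasinf|exists x].
have /choice[x hx] : forall k : nat, exists y, F y < M + k.+1%:R^-1.
  move=> k.
  have [|_ [x _ <-] ?] := @inf_adherent _ (range F) k.+1%:R^-1 _ hasinf.
    by rewrite invr_gt0.
  by exists x.
(* Strong convexity at the midpoint: F(mid) <= (F(u) + F(v)) / 2 - |u - v|^2 / (8 s), while [M]
   bounds F(mid) below. Near-minimizers are therefore close to each other. *)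
have mid u v : norm (u - v) ^+ 2 <= 4 * s * (F u + F v - 2 * M).
  have half : 0 <= (2^-1 : R) <= 1 by lra.
  have := MF (u + 2^-1 *: (v - u)); rewrite FE.
  have /andP[h0 h1] := half; have := subdiff_convex u v h0 h1.
  have -> : u + 2^-1 *: (v - u) - a = 2^-1 *: (u - a) + 2^-1 *: (v - a).
    rewrite addrAC -(subrKA a v (- u)) -(opprB u a); move: (u - a) (v - a) => b c.
    rewrite scalerDr scalerN addrCA addrC -[X in X - _]scale1r -scalerBl.
    by congr (_ *: _ + _); lra.
  rewrite (sqr_enorm ip) !FE.
  have -> : u - v = (u - a) - (v - a) by rewrite opprB addrA subrK.
  move: (u - a) (v - a) => b c; rewrite !(ipE ip) (ipC ip c b) => h2 h3.
  rewrite -ler_pdivrMl ?mulr_gt0//.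
  have -> : (4 * s)^-1 = 2^-1 * (2 * s)^-1 by rewrite -invfM; congr (_^-1); lra.
  move: (2 * s)^-1 h3 => w h3; lra.
have cx : enorm_cauchy dot x.
  move=> e e0; have c0 : 0 < e ^+ 2 / (8 * s).
    by rewrite divr_gt0 ?exprn_gt0 ?mulr_gt0.
  have [N _ N_inv] := near_infty_natSinv_lt (PosNum c0).
  have hN i : (N <= i)%N -> F (x i) < M + e ^+ 2 / (8 * s).
    by move=> Ni; apply: (lt_trans (hx i)); rewrite ltrD2l; exact: N_inv.
  exists N => i j Ni Nj; rewrite -(@ltr_pXn2r _ 2) ?nnegrE ?enorm_ge0 ?(ltW e0)//.
  apply: (le_lt_trans (mid _ _)).
  have -> : e ^+ 2 = 4 * s * (2 * (e ^+ 2 / (8 * s))) by field; rewrite gt_eqF.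
  by rewrite ltr_pM2l ?mulr_gt0//; have := hN _ Ni; have := hN _ Nj; lra.
have [q hq] := complete cx; exists q.
(* Lower semicontinuity of [F] at [q] comes from the subgradient [h] of [F] there. *)
have Fq : F q <= M.
  have [g /subdiff_fin hg] := df_neq0 q.
  pose h := g + s^-1 *: (q - a).
  have Fh y : F q + dot h (y - q) <= F y.
    rewrite !FE -(subrKA q y (- a)) /h; have := hg y.
    have := ip_ge0 ip (y - q).
    move: (y - q) (q - a) => b c; rewrite !(ipE ip) (ipC ip c b) => h1 h2.
    have : 0 <= (2 * s)^-1 * dot b b by rewrite mulr_ge0// ltW.
    have -> : s^-1 = 2 * (2 * s)^-1 by rewrite invfM mulrA divff// mul1r.
    lra.
  apply/ler_addgt0Pr => e e0.
  have e2 : 0 < e / 2 by lra.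
  have nh : 0 < norm h + 1 by rewrite ltr_wpDl ?enorm_ge0.
  near \oo => k.
  have h1 : F (x k) < M + e / 2.
    apply: (lt_trans (hx k)); rewrite ltrD2l.
    near: k; exact: near_infty_natSinv_lt (PosNum e2).
  have h2 : norm (x k - q) < e / 2 / (norm h + 1).
    rewrite -[ltLHS]ger0_norm ?enorm_ge0//; near: k.
    by move/cvgr0_norm_lt: hq; apply; rewrite divr_gt0.
  have := Fh (x k); rewrite -(opprB q (x k)) (ipNr ip).
  have := cauchy_schwarz ip h (q - x k).
  have h3 : norm h * norm (q - x k) <= e / 2.
    apply: (@le_trans _ _ ((norm h + 1) * (e / 2 / (norm h + 1)))).
      by rewrite ler_pM ?enorm_ge0 ?lerDl// (enormBC ip) ltW.
    by rewrite mulrC divfK ?gt_eqF.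
  lra.
(* First-order condition at the minimizer [q]: the quadratic part of [F] contributes its gradient
   and a term of order e^2. *)
apply/subdiff_fin => y; rewrite -lerBrDl -subr_ge0.
apply: (@segment_ge0 _ _ ((2 * s)^-1 * dot (y - q) (y - q))) => e e0 e1.
have := le_trans Fq (MF (q + e *: (y - q))).
have := subdiff_convex q y (ltW e0) e1.
rewrite !FE addrAC; move: (y - q) => c; rewrite -(opprB q a).
move: (q - a) => b; rewrite !(ipE ip) (ipC ip c b).
have -> : s^-1 = 2 * (2 * s)^-1 by rewrite invfM mulrA divff// mul1r.
lra.
Unshelve. all: by end_near. Qed.

End ProxExistence.

(** * Matrices and real sequences *)

Section Matrices.
Context {R : realType}.

Lemma dotF_ip m n : inner_product (@dotF R m n).
Proof.
split.
- by move=> u v; do 2!(apply: eq_bigr => ? _); rewrite mulrC.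
- move=> u v w; rewrite -big_split; apply: eq_bigr => i _; rewrite -big_split.
  by apply: eq_bigr => j _; rewrite mxE mulrDl.
- move=> a u v; rewrite mulr_sumr; apply: eq_bigr => i _; rewrite mulr_sumr.
  by apply: eq_bigr => j _; rewrite mxE mulrA.
- by move=> u; do 2!(apply: sumr_ge0 => ? _); rewrite -expr2 sqr_ge0.
- move=> u u0; apply/matrixP => i j; rewrite mxE.
  have sq a b : 0 <= u a b * u a b by rewrite -expr2 sqr_ge0.
  have /psumr_eq0P/(_ u0) row0 : forall a, true -> 0 <= \sum_j u a j * u a j.
    by move=> a _; apply: sumr_ge0.
  have /psumr_eq0P/(_ (row0 i isT))/(_ j isT)/eqP :
      forall b, true -> 0 <= u i b * u i b by [].
  by rewrite mulf_eq0 orbb => /eqP.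
Qed.

Lemma dotX_ip (U V : lmodType R) (dU : U -> U -> R) (dV : V -> V -> R) :
  inner_product dU -> inner_product dV -> inner_product (dotX dU dV).
Proof.
move=> iU iV; split.
- by move=> u v; rewrite /dotX (ipC iU) (ipC iV).
- by move=> u v w; rewrite /dotX (ipDl iU) (ipDl iV) addrACA.
- by move=> a u v; rewrite /dotX (ipZl iU) (ipZl iV) mulrDr.
- by move=> u; rewrite addr_ge0 ?(ip_ge0 iU) ?(ip_ge0 iV).
- move=> [u v] /eqP; rewrite paddr_eq0 ?(ip_ge0 iU) ?(ip_ge0 iV)//=.
  by move=> /andP[/eqP/(ip_eq0 iU) -> /eqP/(ip_eq0 iV) ->].
Qed.

Lemma enorm_dotX_le (U V : lmodType R) (dU : U -> U -> R) (dV : V -> V -> R) :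
  inner_product dU -> inner_product dV ->
  forall u, enorm (dotX dU dV) u <= enorm dU u.1 + enorm dV u.2.
Proof.
move=> iU iV u.
have nU := enorm_ge0 (dot := dU) u.1; have nV := enorm_ge0 (dot := dV) u.2.
rewrite -(@ler_pXn2r _ 2) ?nnegrE ?addr_ge0 ?enorm_ge0//.
rewrite (sqr_enorm (dotX_ip iU iV)) sqrrD (sqr_enorm iU) (sqr_enorm iV) /dotX.
by rewrite addrAC lerDl mulrn_wge0// mulr_ge0.
Qed.

Lemma ler_coord_normF m n (M : 'M[R]_(m, n)) i j : `|M i j| <= normF M.
Proof.
rewrite -sqrtr_sqr ler_wsqrtr// /dotF (bigD1 i)//= (bigD1 j)//= -addrA lerDl.
by rewrite addr_ge0// sumr_ge0// => *;
  rewrite ?sumr_ge0// => *; rewrite -expr2 sqr_ge0.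
Qed.

Lemma normF_cvg0 m n (x : nat -> 'M[R]_(m, n)) l :
  normF (x k - l) @[k --> \oo] --> 0 -> x @ \oo --> l.
Proof.
move=> h; apply/cvg_ballP => e e0; near=> k; split=> // i j.
rewrite -ball_normE /=; apply: (@le_lt_trans _ _ (normF (x k - l))).
  by rewrite distrC (le_trans _ (ler_coord_normF _ i j))// !mxE.
near: k; move/cvgr0_norm_lt: h => /(_ _ e0); apply: filterS => k.
by apply: le_lt_trans; exact: ler_norm.
Unshelve. all: by end_near. Qed.

Lemma cvg_normF0 m n (x : nat -> 'M[R]_(m, n)) (l : 'M[R]_(m, n)) :
  x @ \oo --> l -> normF (x k - l) @[k --> \oo] --> 0.
Proof.
move=> h; rewrite -sqrtr0; apply: continuous_cvg; first exact: sqrt_continuous.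
have -> : 0 = \sum_(i < m) \sum_(j < n) (l i j - l i j) * (l i j - l i j) :> R.
  by rewrite big1// => i _; rewrite big1// => j _; rewrite subrr mul0r.
apply: cvg_big => [|i _]; first exact: add_continuous.
apply: cvg_big => [|j _]; first exact: add_continuous.
have c : (x k - l) i j @[k --> \oo] --> l i j - l i j.
  under eq_fun do rewrite !mxE.
  apply: cvgB; last exact: cvg_cst.
  apply: (@cvg_comp _ _ _ x (fun M : 'M[R]_(m, n) => M i j) _ _ _ h).
  exact: coord_continuous.
exact: cvgM.
Qed.

Lemma normF_complete m n (x : nat -> 'M[R]_(m, n)) : enorm_cauchy (@dotF R m n) x ->
  exists l, normF (x k - l) @[k --> \oo] --> 0.
Proof.
move=> h; suff /cvg_ex[l xl] : cvg (x @ \oo) by exists l; exact: cvg_normF0.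
apply: cauchy_cvg; apply/cauchy_ballP => e e0.
have [N hN] := h _ e0.
rewrite near_map2; near=> a b => /=; split=> // i j; rewrite -ball_normE /=.
apply: (@le_lt_trans _ _ (normF (x a - x b))).
  by rewrite (le_trans _ (ler_coord_normF _ i j))// !mxE.
apply: hN; [near: a|near: b]; exact: nbhs_infty_ge.
Unshelve. all: by end_near. Qed.

End Matrices.

Lemma nonneg_series_cauchy (R : realType) (u : nat -> R) :
  (forall k, 0 <= u k) -> (\sum_(0 <= k <oo) (u k)%:E < +oo)%E ->
  u @ \oo --> 0 /\
  forall e, 0 < e -> exists N, forall m n, (N <= m)%N -> (m <= n)%N ->
     \sum_(m <= k < n) u k < e.
Proof.
move=> u0 ua; have c := nnseries_is_cvg u0 ua.
split; first exact: cvg_series_cvg_0.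
move=> e e0; have : cauchy (series u @ \oo) by exact: cvg_cauchy.
move=> /cauchy_seriesP/(_ _ e0) [[A B] /= [[N1 _ h1] [N2 _ h2]] h].
exists (maxn N1 N2) => m n; rewrite geq_max => /andP[m1 m2] mn.
apply: le_lt_trans (ler_norm _) _; apply: (h (m, n)); split; [exact: h1|apply: h2].
by rewrite /= (leq_trans m2).
Qed.
(** * Duality between (P) and (D) *)

Section Duality.
Context {R : realType} {p n : nat}.
Variables (A : 'M[R]_(p, n)) (lam : R) (I : {set 'I_p * 'I_p}).
Hypothesis lam_gt0 : 0 < lam.

Local Notation vec := 'cV[R]_(tdim I).
Local Notation mat := 'M[R]_(p, n).
Local Notation S := (@Sop R p n A I).
Local Notation "S^*" := (@Sadj R p n A I).
Local Notation e1 := (e1 R I).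
Local Notation e2 := (e2 R I).
Local Notation blam := (@blam R p lam I).
Local Notation Gam := (@Gam R p n A lam I).
Local Notation ipF := (@dotF_ip R _ _).

(** A coordinate is either diagonal or strictly above the diagonal; the coordinatewise arguments
    below split on this. *)
Lemma e1_e2 k : (e1 k 0 = 1 /\ e2 k 0 = 0) \/ (e1 k 0 = 0 /\ e2 k 0 = 2).
Proof.
rewrite /Defs.e1 /Defs.e2 !mxE; case: eqP => _; [left|right]; split=> //=.
  by rewrite subrr mulr0.
by rewrite subr0 mulr1.
Qed.

Lemma dotF_col (u v : vec) : dotF u v = \sum_k u k 0 * v k 0.
Proof. by apply: eq_bigr => k _; rewrite big_ord1. Qed.

Lemma hadamardE (u v : vec) k : hadamard u v k 0 = u k 0 * v k 0.
Proof. by rewrite mxE. Qed.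

(** Lets the linearity of [S] and [S^*] be read off the adjoint identity [dotF_Sop]. *)
Lemma dotF_inj m q (M N : 'M[R]_(m, q)) : (forall Y, dotF Y M = dotF Y N) -> M = N.
Proof.
move=> h; apply/eqP; rewrite -subr_eq0; apply/eqP/(ip_eq0 ipF).
by rewrite (ipDr ipF) (ipNr ipF) h subrr.
Qed.

Lemma SadjD (u v : vec) : S^* (u + v) = S^* u + S^* v.
Proof. by apply: dotF_inj => Y; rewrite (ipDr ipF) -!dotF_Sop (ipDr ipF). Qed.

Lemma SadjZ a (u : vec) : S^* (a *: u) = a *: S^* u.
Proof. by apply: dotF_inj => Y; rewrite (ipZr ipF) -!dotF_Sop (ipZr ipF). Qed.

Lemma SopD (Y Y' : mat) : S (Y + Y') = S Y + S Y'.
Proof.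
by apply: dotF_inj => v; rewrite (ipDr ipF) !(ipC ipF v) !dotF_Sop (ipDl ipF).
Qed.

Lemma SopZ a (Y : mat) : S (a *: Y) = a *: S Y.
Proof.
by apply: dotF_inj => v; rewrite [RHS](ipZr ipF) !(ipC ipF v) !dotF_Sop (ipZl ipF).
Qed.

Lemma SopB (Y Y' : mat) : S (Y - Y') = S Y - S Y'.
Proof. by rewrite SopD -scaleN1r SopZ scaleN1r. Qed.

(* The support function of [blam]. *)
Definition supp (x : vec) : R := lam / 2 * norm1 (hadamard x e2).

Lemma suppE x : supp x = \sum_k lam / 2 * (`|x k 0| * e2 k 0).
Proof.
rewrite /supp mulr_sumr; apply: eq_bigr => k _; rewrite hadamardE normrM.
by case: (e1_e2 k) => -[_ ->]; rewrite ?normr0 ?normr_nat.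
Qed.

Lemma GamE x : Gam x = 2^-1 * dotF (S^* x) (S^* x) - dotF x e1 + supp x.
Proof. by rewrite /Defs.Gam /normF (sqr_enorm ipF). Qed.

Lemma suppZ a x : supp (a *: x) = `|a| * supp x.
Proof.
rewrite !suppE mulr_sumr; apply: eq_bigr => k _; rewrite mxE normrM.
by ring.
Qed.

Lemma dotF_le_supp z x : blam z -> dotF z x <= supp x.
Proof.
move=> [z0 zlam]; rewrite dotF_col suppE; apply: ler_sum => k _.
apply: (le_trans (ler_norm _)); rewrite normrM.
have := congr1 (fun M : vec => M k 0) z0; rewrite hadamardE [RHS]mxE.
case: (e1_e2 k) => -[-> ->].
  by rewrite mul1r => ->; rewrite normr0 mul0r !mulr0.
by move=> _; rewrite [X in _ <= _ * X]mulrC mulrA divfK// ler_wpM2r.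
Qed.

(** Converse of [dotF_le_supp], obtained by testing signed unit vectors: they bound the coordinate
    by 0 on the diagonal and by [lam] off it. *)
Lemma supp_blam z : (forall u, dotF z u <= supp u) -> blam z.
Proof.
move=> h.
have hk k : `|z k 0| <= lam / 2 * e2 k 0.
  have dz a : dotF z (a *: delta_mx k 0) = a * z k 0.
    rewrite (ipZr ipF) dotF_col (bigD1 k)//= !mxE !eqxx mulr1 big1 ?addr0// => l lk.
    by rewrite mxE (negPf lk) mulr0.
  have sz : supp (delta_mx k 0) = lam / 2 * e2 k 0.
    rewrite suppE (bigD1 k)//= !mxE !eqxx normr1 mul1r big1 ?addr0// => l lk.
    by rewrite mxE (negPf lk) normr0 mul0r mulr0.
  rewrite ler_norml; apply/andP; split.
    by have := h (-1 *: delta_mx k 0); rewrite dz suppZ sz normrN1; lra.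
  by have := h (1 *: delta_mx k 0); rewrite dz suppZ sz normr1; lra.
split=> [|k]; last first.
  apply: (le_trans (hk k)); case: (e1_e2 k) => -[_ ->].
    by rewrite mulr0 ltW.
  by rewrite divfK.
apply/matrixP => k j; rewrite ord1 hadamardE [RHS]mxE; have := hk k.
case: (e1_e2 k) => -[-> ->]; last by rewrite mul0r.
by rewrite mulr0 normr_le0 mul1r => /eqP.
Qed.

Lemma supp_attained x : exists2 z, blam z & dotF z x = supp x.
Proof.
(* [lam] times the sign of [x] off the diagonal, 0 on it. *)
pose z : vec := \col_k (lam / 2 * (Num.sg (x k 0) * e2 k 0)).
have zx : dotF z x = supp x.
  rewrite dotF_col suppE; apply: eq_bigr => k _.
  by rewrite mxE [in RHS]normrEsg -!mulrA; congr (_ * (_ * (_ * _))); rewrite mulrC.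
exists z => //; apply: supp_blam => u; rewrite dotF_col suppE; apply: ler_sum => k _.
have lam2 : 0 < lam / 2 by rewrite divr_gt0.
have e20 : 0 <= e2 k 0 by case: (e1_e2 k) => -[_ ->].
rewrite mxE -mulrA ler_wpM2l ?(ltW lam2)// mulrAC ler_wpM2r//.
apply: (le_trans (ler_norm _)).
rewrite normrM normr_sg; case: (x k 0 == 0); rewrite ?mul0r ?mul1r//.
Qed.

Lemma blam_convex z z' s : 0 <= s -> s <= 1 -> blam z -> blam z' ->
  blam (z + s *: (z' - z)).
Proof.
move=> s0 s1 bz bz'; apply: supp_blam => u; rewrite !(ipE ipF).
have h1 : (1 - s) * dotF z u <= (1 - s) * supp u.
  by rewrite ler_wpM2l ?subr_ge0 ?dotF_le_supp.
have h2 : s * dotF z' u <= s * supp u by rewrite ler_wpM2l ?dotF_le_supp.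
lra.
Qed.

Lemma supp_convex x y s : 0 <= s -> s <= 1 ->
  supp (x + s *: (y - x)) <= (1 - s) * supp x + s * supp y.
Proof.
move=> s0 s1; have [z bz <-] := supp_attained (x + s *: (y - x)).
rewrite !(ipE ipF).
have h1 : (1 - s) * dotF z x <= (1 - s) * supp x.
  by rewrite ler_wpM2l ?subr_ge0 ?dotF_le_supp.
have h2 : s * dotF z y <= s * supp y by rewrite ler_wpM2l ?dotF_le_supp.
lra.
Qed.

(** The smooth part of [Gam] is quadratic, so its expansion is exact and only the increment of
    [supp] stays implicit. *)
Lemma Gam_expand x v : Gam (x + v) =
  Gam x + dotF (S (S^* x) - e1) v + 2^-1 * dotF (S^* v) (S^* v)
  + (supp (x + v) - supp x).
Proof.
rewrite !GamE SadjD (ipDl ipF (S _)) (ipNl ipF) dotF_Sop.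
move: (S^* v) (S^* x) => b a; rewrite !(ipE ipF) (ipC ipF b a) (ipC ipF e1 v).
lra.
Qed.

(** Sum rule: [S (S^* x) - e1] is the gradient of the smooth part, and the [z] allowed here are the
    subgradients at [x] of the support function. *)
Lemma dGamP x v : dGam A lam x v <->
  exists z, [/\ blam z, dotF z x = supp x & v = S (S^* x) - e1 + z].
Proof.
split=> [/subdiff_fin h|[z [bz zx ->]]]; last first.
  apply/subdiff_fin => x'; have [d ->] : exists d, x' = x + d.
    by exists (x' - x); rewrite addrC subrK.
  rewrite [x + d - x]addrAC subrr add0r Gam_expand.
  rewrite (ipDl ipF (S (S^* x) - e1)).
  have := dotF_le_supp (x + d) bz; rewrite (ipDr ipF) zx.
  have := ip_ge0 ipF (S^* d); lra.
pose z := v - (S (S^* x) - e1).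
have zE w : dotF z w = dotF v w - dotF (S (S^* x) - e1) w.
  by rewrite (ipDl ipF v) (ipNl ipF).
(* Along the segment from [x] to [u] the quadratic term is of second order, which leaves [z] as a
   subgradient of [supp]. *)
have hz u : supp x + dotF z (u - x) <= supp u.
  rewrite -subr_ge0; set D := S^* (u - x).
  apply: (@segment_ge0 _ _ (2^-1 * dotF D D)) => s s0 s1; rewrite /D.
  have := h (x + s *: (u - x)); rewrite [x + _ - x]addrAC subrr add0r.
  rewrite Gam_expand SadjZ (ipZl ipF s (S^* _)) (ipZr ipF s (S^* _)).
  rewrite zE (ipZr ipF s v) (ipZr ipF s (S _ - _)).
  have := supp_convex x u (ltW s0) s1; lra.
(* By positive homogeneity, the inequality at 0 and at 2 x gives the two directions. *)
have zx : dotF z x = supp x.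
  have := hz 0; have := hz (2 *: x); rewrite sub0r (ipNr ipF).
  rewrite (scaler_nat 2) mulr2n addrK -mulr2n -scaler_nat suppZ normr_nat.
  have -> : supp 0 = 0 by rewrite -(scale0r 0) suppZ normr0 mul0r.
  lra.
exists z; split=> //; last by rewrite /z addrC subrK.
by apply: supp_blam => u; have := hz u; rewrite (ipDr ipF) (ipNr ipF) zx; lra.
Qed.

Lemma dGam_neq0 (x : vec) : dGam A lam x !=set0.
Proof.
have [z bz zx] := supp_attained x.
by exists (S (S^* x) - e1 + z); apply/dGamP; exists z.
Qed.

Local Notation res yz := (S yz.1 + yz.2 - e1).
Local Notation objD := (@objD R p n lam I).
Local Notation Lagr := (@Lagr R p n A lam I).
Local Notation augLagr := (@augLagr R p n A lam I).
Local Notation dotYZ := (dotYZ p n I).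

(* Values of [Lagr] and [augLagr] on [z \in blam], where they are finite. *)
Definition lagr (yz : mat * vec) (x : vec) : R :=
  2^-1 * dotF yz.1 yz.1 - dotF (res yz) x.

Definition aug (s : R) (yz : mat * vec) (x : vec) : R :=
  lagr yz x + s / 2 * dotF (res yz) (res yz).

Lemma objD_blam yz : blam yz.2 -> objD yz = (2^-1 * dotF yz.1 yz.1)%:E.
Proof.
by move=> b; rewrite /Defs.objD /indicator mem_set// adde0 /normF (sqr_enorm ipF).
Qed.

Lemma objD_notin yz : ~ blam yz.2 -> objD yz = +oo%E.
Proof. by move=> b; rewrite /Defs.objD /indicator memNset. Qed.

Lemma Lagr_blam yz x : blam yz.2 -> Lagr yz x = (lagr yz x)%:E.
Proof. by move=> b; rewrite /Defs.Lagr objD_blam. Qed.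

Lemma Lagr_notin yz x : ~ blam yz.2 -> Lagr yz x = +oo%E.
Proof. by move=> b; rewrite /Defs.Lagr objD_notin. Qed.

Lemma augLagr_blam s yz x : blam yz.2 -> augLagr s yz x = (aug s yz x)%:E.
Proof.
by move=> b; rewrite /Defs.augLagr Lagr_blam// /normF (sqr_enorm ipF).
Qed.

Lemma augLagr_notin s yz x : ~ blam yz.2 -> augLagr s yz x = +oo%E.
Proof. by move=> b; rewrite /Defs.augLagr Lagr_notin. Qed.

Lemma lagrE yz x :
  lagr yz x = 2^-1 * dotF yz.1 yz.1 - dotF yz.1 (S^* x) - dotF yz.2 x + dotF e1 x.
Proof.
rewrite /lagr !(ipDl ipF (_ + _)) (ipDl ipF (S _)) (ipNl ipF) dotF_Sop; lra.
Qed.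

(** The two variables are bounded separately: |Y - S^* x|^2 >= 0 handles [Y], the support function
    handles [z]. *)
Lemma weak_duality yz x : blam yz.2 -> - Gam x <= lagr yz x.
Proof.
move=> b; rewrite GamE lagrE (ipC ipF x).
have := ip_ge0 ipF (yz.1 - S^* x); have := dotF_le_supp x b.
by move: (S^* x) => a; rewrite !(ipE ipF) (ipC ipF a); lra.
Qed.

(* Completing the square in the dual variable: the augmented Lagrangian is the
   Moreau envelope of the Lagrangian, attained at the multiplier update. *)
Lemma augE s yz x x' : 0 < s -> aug s yz x =
  lagr yz x' - (2 * s)^-1 * dotF (x' - x) (x' - x)
  + (2 * s)^-1 * dotF (x' - (x - s *: res yz)) (x' - (x - s *: res yz)).
Proof.
move=> s0; have [d ->] : exists d, x' = x + d.
  by exists (x' - x); rewrite addrC subrK.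
rewrite /aug /lagr; move: (res yz) => c.
rewrite [x + d - x]addrAC subrr add0r opprB [x + d + _]addrC subrKA.
rewrite !(ipE ipF) (ipC ipF d c).
by field; rewrite gt_eqF.
Qed.

Lemma augLagr_lower s yz x q : 0 < s -> blam yz.2 ->
  - Gam q - (2 * s)^-1 * dotF (q - x) (q - x)
  + (2 * s)^-1 * dotF (q - (x - s *: res yz)) (q - (x - s *: res yz)) <= aug s yz x.
Proof. by move=> s0 b; rewrite (augE yz x q s0) 2!lerD2r weak_duality. Qed.

Lemma inf_augLagr s (x q : vec) : 0 < s -> dGam A lam q (s^-1 *: (x - q)) ->
  ereal_inf (range (fun yz => augLagr s yz x))
  = (- Gam q - (2 * s)^-1 * dotF (q - x) (q - x))%:E.
Proof.
move=> s0 /dGamP[z [bz zq xq]]; apply/eqP; rewrite eq_le; apply/andP; split.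
  (* The residual of this pair is (x - q) / s, so its multiplier update is [q] itself and weak
     duality is an equality there. *)
  pose y : mat * vec := (S^* q, z).
  apply: ge_ereal_inf; exists (augLagr s y x); first by exists y.
  rewrite augLagr_blam// lee_fin (augE y x q s0).
  have -> : res y = s^-1 *: (x - q) by rewrite xq addrAC.
  rewrite scalerA divff ?gt_eqF// scale1r subKr subrr (ip0l ipF) mulr0 addr0 lerD2r.
  by rewrite lagrE /= zq GamE (ipC ipF e1); lra.
apply: le_ereal_inf_tmp => _ [yz _ <-].
have [b|b] := pselect (blam yz.2); last by rewrite augLagr_notin// leey.
rewrite augLagr_blam// lee_fin (le_trans _ (augLagr_lower x q s0 b))//.
by rewrite lerDl mulr_ge0 ?(ip_ge0 ipF)// invr_ge0 mulr_ge0 ?ltW.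
Qed.

(** [gapPsi] for arbitrary arguments; at the iterates the two are convertible. *)
Definition gap s yz x : \bar R :=
  (augLagr s yz x - ereal_inf (range (fun yz => augLagr s yz x)))%E.

Section Gap.
Variables (s : R) (yz : mat * vec) (x q : vec) (g : R).
Hypotheses (s0 : 0 < s) (xq : dGam A lam q (s^-1 *: (x - q)))
  (gap_le : (gap s yz x <= g%:E)%E).

Lemma gap_blam : blam yz.2.
Proof.
apply: contrapT => b; move: gap_le.
by rewrite /gap (inf_augLagr s0 xq) augLagr_notin.
Qed.

Lemma gap_aug :
  aug s yz x <= - Gam q - (2 * s)^-1 * dotF (q - x) (q - x) + g.
Proof.
move: gap_le; rewrite /gap (inf_augLagr s0 xq) augLagr_blam; last exact: gap_blam.
by rewrite -EFinB lee_fin lerBlDl.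
Qed.

(** The lower bound [augLagr_lower] exceeds the infimum by |q - (x - s res)|^2 / (2 s), and the gap
    controls this excess. *)
Lemma gap_prox : normF (x - s *: res yz - q) ^+ 2 <= 2 * s * g.
Proof.
have := le_trans (augLagr_lower x q s0 gap_blam) gap_aug; rewrite lerD2l.
rewrite mulrC ler_pdivrMr ?mulr_gt0// -(sqr_enorm ipF) (enormBC ipF).
by rewrite mulrC.
Qed.

(** At a feasible point the multiplier and penalty terms vanish, so the infimum is at most the
    objective of (D) there. *)
Lemma gap_feasible yz' : blam yz'.2 -> res yz' = 0 ->
  aug s yz x <= 2^-1 * dotF yz'.1 yz'.1 + g.
Proof.
move=> b c0; apply: (le_trans gap_aug); rewrite lerD2r -lee_fin -(inf_augLagr s0 xq).
apply: ge_ereal_inf; exists (augLagr s yz' x); first by exists yz'.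
by rewrite augLagr_blam// lee_fin /aug /lagr c0 !(ip0l ipF); lra.
Qed.

End Gap.

(** The Lagrangian is affine in [x] with slope minus the residual; with the sign in [TL], the second
    component must be the residual. *)
Lemma TLP yz x v : TL A lam (yz, x) v ->
  [/\ blam yz.2, v.2 = res yz & forall yz', blam yz'.2 ->
      lagr yz x + dotYZ v.1 (yz' - yz) <= lagr yz' x].
Proof.
case: v => u c [[/= fin hu] [_ hc]].
have b : blam yz.2 by apply: contrapT => b; rewrite Lagr_notin in fin.
split=> //= [|yz' b']; last first.
  by have := hu yz'; rewrite !Lagr_blam// -EFinD lee_fin.
apply/eqP; rewrite -subr_eq0; apply/eqP/(ip_eq0 ipF).
have := hc (x + (c - res yz)); rewrite !Lagr_blam// -EFinD lee_fin /lagr.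
rewrite [x + _ - x]addrAC subrr add0r; move: (res yz) => d.
rewrite (ipDr ipF d x) (ipNl ipF c) (ipDl ipF c); have := ip_ge0 ipF (c - d).
rewrite (ipDl ipF c (- d)) (ipNl ipF d); lra.
Qed.

Lemma TL_intro yz x u : blam yz.2 ->
  (forall yz', blam yz'.2 -> lagr yz x + dotYZ u (yz' - yz) <= lagr yz' x) ->
  TL A lam (yz, x) (u, res yz).
Proof.
move=> b h; split; (split; first by rewrite Lagr_blam) => x' /=;
  rewrite Lagr_blam//.
  have [b'|b'] := pselect (blam x'.2); last by rewrite Lagr_notin// leey.
  by rewrite Lagr_blam// -EFinD lee_fin h.
rewrite Lagr_blam// -EFinD lee_fin /lagr; move: (res yz) => d.
rewrite (ipNl ipF d) (ipDr ipF d) (ipNr ipF d); lra.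
Qed.

(** To first order in [e], the augmented Lagrangian varies as the Lagrangian at the multiplier x - s
    c, and convexity of |Y|^2 / 2 extends this to the full step; the rest is of order e^2. *)
Lemma aug_segment (Y d : mat) (c D x : vec) s e w : 0 <= e ->
  2^-1 * dotF Y Y - dotF c x + s / 2 * dotF c c + e * w <=
  2^-1 * dotF (Y + e *: d) (Y + e *: d) - dotF (c + e *: D) x
    + s / 2 * dotF (c + e *: D) (c + e *: D) ->
  0 <= e * (2^-1 * dotF (Y + d) (Y + d) - dotF (c + D) (x - s *: c)
            - (2^-1 * dotF Y Y - dotF c (x - s *: c) + w))
       + e ^+ 2 * (s / 2 * dotF D D + 2^-1 * dotF d d).
Proof.
move=> e0; have := mulr_ge0 e0 (ip_ge0 ipF d).
rewrite !(ipE ipF) (ipC ipF D c) (ipC ipF d Y); lra.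
Qed.

Lemma subdiff_augLagr_TL s yz x u : 0 < s -> blam yz.2 ->
  subdiff dotYZ (fun yz => augLagr s yz x) yz u ->
  TL A lam (yz, x - s *: res yz) (u, res yz).
Proof.
move=> s0 b [_ h]; apply: TL_intro => // yz' b'.
set x1 := x - _.
pose D := res yz' - res yz.
rewrite -subr_ge0; apply: (@segment_ge0 _ _ (s / 2 * dotF D D
  + 2^-1 * dotF (yz'.1 - yz.1) (yz'.1 - yz.1))) => e e0 e1'.
pose ye := yz + e *: (yz' - yz).
have be : blam ye.2 by apply: blam_convex => //; exact: ltW.
have re : res ye = res yz + e *: D.
  rewrite /ye /D /= SopD SopZ SopB opprB subrKA opprD.
  move: (S yz'.1) (S yz.1) yz'.2 yz.2 => a' a z' z.
  by rewrite (addrACA a') (scalerDr e (a' - a)) (addrACA a) [LHS]addrAC.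
have := h ye; rewrite !augLagr_blam// -EFinD lee_fin.
rewrite {2}/ye [yz + _ - yz]addrAC subrr add0r.
rewrite /aug /lagr re /Defs.dotYZ (ipZr (dotX_ip ipF ipF)).
have -> : res yz' = res yz + D by rewrite /D [RHS]addrC subrK.
have -> : (yz + e *: (yz' - yz)).1 = yz.1 + e *: (yz'.1 - yz.1) by [].
have -> : yz'.1 = yz.1 + (yz'.1 - yz.1) by rewrite addrC subrK.
rewrite [yz.1 + _ - yz.1]addrAC subrr add0r.
exact: aug_segment (ltW e0).
Qed.

(** * Saddle points and the optimal pair of (D) *)

Section Saddle.
Variables (xs zs : vec).
Hypotheses (bzs : blam zs) (zxs : dotF zs xs = supp xs)
  (KKT : 0 = S (S^* xs) - e1 + zs).
Let ys : mat * vec := (S^* xs, zs).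

Lemma saddle_feasible : res ys = 0.
Proof. by rewrite /= KKT addrAC. Qed.

(** Strong convexity of |Y|^2 / 2 around [S^* xs]; this growth drives both the uniqueness and the
    convergence of [Y]. *)
Lemma saddle_growth yz : blam yz.2 ->
  dotF (res yz) xs + 2^-1 * dotF (yz.1 - S^* xs) (yz.1 - S^* xs)
  <= 2^-1 * dotF yz.1 yz.1 - 2^-1 * dotF (S^* xs) (S^* xs).
Proof.
move=> b; have h := dotF_le_supp xs b.
have KKTx : dotF (S^* xs) (S^* xs) + dotF zs xs - dotF e1 xs = 0.
  have := congr1 (fun c : vec => dotF c xs) KKT.
  rewrite (ip0l ipF) (ipDl ipF (S _ - e1)) (ipDl ipF (S _)) (ipNl ipF) dotF_Sop; lra.
rewrite !(ipDl ipF (_ + _)) (ipDl ipF (S _)) (ipNl ipF e1) dotF_Sop.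
move: h KKTx; rewrite -zxs; move: (S^* xs) => a.
by rewrite !(ipE ipF) (ipC ipF a yz.1); lra.
Qed.

(** Growth on the feasible set determines [Y]; the constraint then determines [z]. *)
Lemma sol_dual_saddle : sol_dual A lam I = [set ys].
Proof.
have feas : feasD A ys.
  by apply/eqP; rewrite -subr_eq0; apply/eqP; exact: saddle_feasible.
have blamD yz : (objD yz < +oo)%E -> blam yz.2.
  by move=> h; apply: contrapT => /objD_notin h'; rewrite h' ltxx in h.
have growth yz : feasD A yz -> blam yz.2 ->
    2^-1 * dotF (S^* xs) (S^* xs) + 2^-1 * dotF (yz.1 - S^* xs) (yz.1 - S^* xs)
    <= 2^-1 * dotF yz.1 yz.1.
  move=> f b; have := saddle_growth b; rewrite f subrr (ip0l ipF); lra.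
apply/seteqP; split=> [yz [f fin opt]|_ ->]; last first.
  split=> //; first by rewrite objD_blam// ltry.
  move=> yz' f; have [b|b] := pselect (blam yz'.2); last first.
    by rewrite (objD_notin b) leey.
  rewrite !objD_blam// lee_fin; have := growth _ f b.
  have := ip_ge0 ipF (yz'.1 - S^* xs); rewrite /=; lra.
have b := blamD _ fin; have := opt _ feas; rewrite !objD_blam// lee_fin => h.
have /eqP : dotF (yz.1 - S^* xs) (yz.1 - S^* xs) = 0.
  apply/eqP; rewrite eq_le (ip_ge0 ipF) andbT.
  have := growth _ f b; move: h => /=; lra.
move=> /eqP/(ip_eq0 ipF)/eqP; rewrite subr_eq0 => /eqP Y1.
move: f feas; rewrite /feasD /= Y1 => <- /eqP; rewrite eq_sym.
rewrite (can_eq (addKr _)) => /eqP Z1.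
by case: yz Y1 Z1 {fin opt b h} => Y z /= -> ->.
Qed.

(** Zeros differ only in the multiplier, so the distance to [zerosTL] dominates the error in (Y,
    z). *)
Lemma zerosTL_saddle w : zerosTL A lam I w -> w.1 = ys.
Proof.
case: w => yz x /TLP[/= b c0 h].
have := h ys bzs; rewrite /Defs.dotYZ /dotX !(ip0l ipF) !addr0 /lagr.
rewrite saddle_feasible -c0 !(ip0l ipF) !subr0 /= => h1.
have := saddle_growth b; rewrite -c0 (ip0l ipF) => h2.
have /eqP : dotF (yz.1 - S^* xs) (yz.1 - S^* xs) = 0.
  by apply/eqP; rewrite eq_le (ip_ge0 ipF) andbT; lra.
move=> /eqP/(ip_eq0 ipF)/eqP; rewrite subr_eq0 => /eqP Y1.
have : res yz = res ys by rewrite saddle_feasible -c0.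
rewrite /= Y1 => /addIr/addrI Z1.
by case: yz Y1 Z1 {b c0 h h1 h2} => Y z /= -> ->.
Qed.

Lemma saddle_zerosTL : zerosTL A lam I (ys, xs).
Proof.
have : TL A lam (ys, xs) (0, res ys).
  apply: TL_intro => //= yz b.
  rewrite /lagr saddle_feasible /Defs.dotYZ /dotX !(ip0l ipF) /=.
  have := saddle_growth b; have := ip_ge0 ipF (yz.1 - S^* xs); lra.
by rewrite saddle_feasible.
Qed.

End Saddle.
End Duality.
Lemma Sop_bounded {R : realType} {p n : nat} (A : 'M[R]_(p, n))
    (I : {set 'I_p * 'I_p}) :
  exists2 K : R, 0 <= K & forall Y, normF (@Sop R p n A I Y) <= K * normF Y.
Proof.
have ipF m q := @dotF_ip R m q.
pose del k : 'cV[R]_(tdim I) := delta_mx k 0.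
(* The k-th coordinate of S Y is <Y, S^* e_k>; Cauchy-Schwarz in each coordinate gives this squared
   constant. *)
pose K2 := \sum_k normF (Sadj A (del k)) ^+ 2.
have K20 : 0 <= K2 by apply: sumr_ge0 => k _; exact: sqr_ge0.
exists (Num.sqrt K2) => [|Y]; first exact: sqrtr_ge0.
rewrite -(@ler_pXn2r _ 2) ?nnegrE ?mulr_ge0 ?sqrtr_ge0 ?(enorm_ge0 _)//.
rewrite exprMn {1}/normF (sqr_enorm (ipF _ _)) sqr_sqrtr// dotF_col mulr_suml.
apply: ler_sum => k _.
have -> : @Sop R p n A I Y k 0 = dotF Y (Sadj A (del k)).
  rewrite -dotF_Sop dotF_col (bigD1 k)//= [del k k 0]mxE !eqxx mulr1.
  rewrite big1 ?addr0// => l lk.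
  by rewrite [del k l 0]mxE (negPf lk) mulr0.
rewrite -expr2 -exprMn -real_normK ?num_real//.
rewrite ler_pXn2r ?nnegrE ?mulr_ge0 ?(enorm_ge0 _)//.
by rewrite mulrC (cauchy_schwarz_abs (ipF _ _)).
Qed.
(** * Limits of the rates *)

Section Limits.
Context {R : realType}.
Variables (sigma : nat -> R) (sigmaoo : \bar R).
Hypotheses (sigma0_gt0 : 0 < sigma 0%N) (sigma_nd : nondecreasing_seq sigma)
  (sigma_cvg : (sigma k)%:E @[k --> \oo] --> sigmaoo).

Lemma sigma_ge k : sigma 0%N <= sigma k.
Proof. exact: sigma_nd. Qed.

Lemma sigma_gt0 k : 0 < sigma k.
Proof. exact: lt_le_trans (sigma_ge k). Qed.

(** The infinite limit is recorded as the inverses tending to 0, the form in which both rates use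
    it. *)
Variant sigma_lim_spec : \bar R -> Prop :=
  | SigmaFin (s : R) of 0 < s & sigma @ \oo --> s : sigma_lim_spec s%:E
  | SigmaInfty of (sigma k)^-1 @[k --> \oo] --> 0 : sigma_lim_spec +oo%E.

Lemma sigma_limP : sigma_lim_spec sigmaoo.
Proof.
have ge0 : ((sigma 0%N)%:E <= sigmaoo)%E.
  by apply: (cvge_to_ge sigma_cvg); apply: nearW => k; rewrite lee_fin sigma_ge.
case: sigmaoo sigma_cvg ge0 => [s| |] //= c ge0.
  rewrite lee_fin in ge0.
  by apply: SigmaFin; [exact: lt_le_trans ge0|exact: fine_cvg c].
apply: SigmaInfty; apply/(cvgrVy _).1.
  by apply: nearW => k; rewrite invr_gt0 sigma_gt0.
by apply/cvgeryP; under eq_fun do rewrite /= invrK.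
Qed.

Lemma zeta_inf_lt1 kg : 0 <= kg -> zeta_inf kg sigmaoo < 1.
Proof.
move=> kg0; case: sigma_limP => [s s0 _|_] //=.
have den0 : 0 < kg ^+ 2 + s ^+ 2 by rewrite ltr_wpDl ?sqr_ge0 ?exprn_gt0.
rewrite ltr_pdivrMr ?sqrtr_gt0// mul1r -[ltLHS]ger0_norm// -sqrtr_sqr.
by rewrite ltr_sqrt// ltrDl exprn_gt0.
Qed.

Lemma zeta_cvg kg theta : 0 <= kg -> theta @ \oo --> 0 ->
  zeta kg (theta k) (sigma k) @[k --> \oo] --> zeta_inf kg sigmaoo.
Proof.
move=> kg0 th0; have th1 : 1 - theta k @[k --> \oo] --> (1 : R).
  by rewrite -[X in _ --> X]subr0; apply: cvgB => //; exact: cvg_cst.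
have th2 : theta k + 1 @[k --> \oo] --> (1 : R).
  by rewrite -[X in _ --> X]add0r; apply: cvgD => //; exact: cvg_cst.
suff h : kg * (Num.sqrt (kg ^+ 2 + sigma k ^+ 2))^-1 @[k --> \oo]
    --> zeta_inf kg sigmaoo.
  rewrite /zeta; under eq_fun do rewrite (mulrAC kg).
  have -> : zeta_inf kg sigmaoo = (zeta_inf kg sigmaoo * 1 + 0) * 1^-1.
    by rewrite invr1 !mulr1 addr0.
  apply: cvgM; last by apply: cvgV => //; exact: oner_neq0.
  by apply: cvgD => //; exact: cvgM.
case: sigma_limP => [s s0 c|c] /=.
  have den0 : 0 < kg ^+ 2 + s ^+ 2 by rewrite ltr_wpDl ?sqr_ge0 ?exprn_gt0.
  apply: cvgMr; apply: cvgV; first by rewrite gt_eqF// sqrtr_gt0.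
  apply: continuous_cvg; first exact: sqrt_continuous.
  by apply: cvgD; [exact: cvg_cst|exact: cvgM].
(* In the infinite case the factor lies between 0 and kg / sigma k. *)
apply: (@squeeze_cvgr _ _ _ _ (cst 0) (fun k => kg * (sigma k)^-1)); last 2 first.
- exact: cvg_cst.
- by rewrite -[X in _ --> X](mulr0 kg); exact: cvgMr.
apply: nearW => k; have s0 := sigma_gt0 k.
have den0 : 0 < kg ^+ 2 + sigma k ^+ 2 by rewrite ltr_wpDl ?sqr_ge0 ?exprn_gt0.
rewrite mulr_ge0 ?invr_ge0 ?sqrtr_ge0//= ler_wpM2l// lef_pV2 ?posrE ?sqrtr_gt0//.
by rewrite -[leLHS]gtr0_norm// -sqrtr_sqr ler_wsqrtr// lerDr sqr_ge0.
Qed.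

Lemma zeta'_cvg kl theta' : theta' @ \oo --> 0 ->
  zeta' kl (theta' k) (sigma k) @[k --> \oo] --> zeta'_inf kl sigmaoo.
Proof.
move=> th0; have th1 : kl * (1 + theta' k) @[k --> \oo] --> kl.
  rewrite -[X in _ --> X]mulr1 -[X in _ * X]addr0; apply: cvgMr.
  by apply: cvgD => //; exact: cvg_cst.
case: sigma_limP => [s s0 c|c] /=.
  by apply: cvgM => //; apply: cvgV => //; rewrite gt_eqF.
by rewrite -[X in _ --> X](mulr0 kl); exact: cvgM.
Qed.

End Limits.

Lemma contract_cvg0 (R : realType) (d c : nat -> R) (l : R) :
  (forall k, 0 <= d k) -> l < 1 -> c @ \oo --> l ->
  (\forall k \near \oo, d k.+1 <= c k * d k) ->
  forall e, 0 < e -> \forall k \near \oo, d k < e.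
Proof.
move=> d0 l1 cl h e e0.
(* Strictly between [l] and 1, and nonnegative even when [l] is not, so that the powers of [b] bound
   the decay. *)
pose b := Num.max 0 ((l + 1) / 2).
have b0 : 0 <= b by rewrite le_max lexx.
have b1 : b < 1 by rewrite gt_max ltr01 /=; lra.
have lb : l < b by rewrite lt_max; apply/orP; right; lra.
have [N _ hN] : \forall k \near \oo, d k.+1 <= b * d k.
  near=> k; apply: (@le_trans _ _ (c k * d k)); first by near: k.
  rewrite ler_wpM2r//; apply: ltW; near: k; exact: cvgr_lt cl _ lb.
have geo m : d (N + m)%N <= b ^+ m * d N.
  elim: m => [|m IH]; first by rewrite addn0 mul1r.
  rewrite addnS (le_trans (hN _ _))//= ?leq_addr// exprS -mulrA ler_wpM2l//.
have : b ^+ m * d N @[m --> \oo] --> 0.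
  rewrite -[X in _ --> X](mul0r (d N)); apply: cvgMl.
  by apply: cvg_expr; rewrite ger0_norm.
move=> /cvgr_lt/(_ e e0)[M _ hM].
exists (N + M)%N => // k /= NMk; have Nk := leq_trans (leq_addr _ _) NMk.
rewrite -(subnKC Nk); apply: (le_lt_trans (geo _)); apply: hM.
by rewrite /= leq_subRL.
Unshelve. all: by end_near. Qed.

Lemma cvgr_shiftS (R : realType) (u : nat -> R) (l : R) :
  u k.+1 @[k --> \oo] --> l <-> u @ \oo --> l.
Proof. by rewrite -(cvg_shiftS u). Qed.
(** * The iterates *)

Section Iterates.
Context {R : realType} {p n : nat}.
Variables (A : 'M[R]_(p, n)) (lam : R) (I : {set 'I_p * 'I_p}).
Hypotheses (lam_gt0 : 0 < lam) (sol_neq0 : sol_primal A lam I !=set0).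
Variables (sigma eps theta : nat -> R) (sigmaoo : \bar R) (alpha : R).
Variables (Y : nat -> 'M[R]_(p, n)) (z x : nat -> 'cV[R]_(tdim I)).
Hypotheses (alm : ialm A sigma sigmaoo Y z x)
  (hA : critA A lam sigma Y z x eps alpha).

Local Notation O := (sol_primal A lam I).
Local Notation d := (rdist (@dotF R (tdim I) 1) O).
Local Notation S := (@Sop R p n A I).
Local Notation "S^*" := (@Sadj R p n A I).
Local Notation res k := (S (Y k) + z k - e1 R I).
Local Notation ipF := (@dotF_ip R _ _).

Lemma iter_sigma_gt0 k : 0 < sigma k.
Proof. by case: alm => s0 nd _ _; exact: sigma_gt0. Qed.

(** The value of [Gam] at a solution bounds it below, so proximal points exist. *)
Lemma iter_prox : exists q : nat -> 'cV[R]_(tdim I),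
  forall k, dGam A lam (q k) ((sigma k)^-1 *: (x k - q k)).
Proof.
have [xo /subdiff_fin Oxo] := sol_neq0.
suff /choice[q hq] : forall k, exists q, dGam A lam q ((sigma k)^-1 *: (x k - q)).
  by exists q.
move=> k; apply: (prox_exists ipF (@normF_complete _ _ _) _ _ (iter_sigma_gt0 k)).
  exact: dGam_neq0.
by move=> y; have := Oxo y; rewrite (ip0l ipF) addr0; exact.
Qed.

Lemma sum_eps_le m : \sum_(0 <= k < m) eps k <= alpha.
Proof.
case: hA => eps0 _ h; rewrite -lee_fin (le_trans _ h)//.
rewrite -sumEFin; apply: nneseries_lim_ge => k _ _.
by rewrite lee_fin eps0.
Qed.

Lemma eps_tail : eps @ \oo --> 0 /\
  forall e, 0 < e -> exists N, forall m n, (N <= m)%N -> (m <= n)%N ->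
     \sum_(m <= k < n) eps k < e.
Proof.
case: hA => eps0 _ h; apply: nonneg_series_cauchy => //.
by rewrite (le_lt_trans h)// ltry.
Qed.

Section Prox.
Variable q : nat -> 'cV[R]_(tdim I).
Hypothesis hq : forall k, dGam A lam (q k) ((sigma k)^-1 *: (x k - q k)).

(** Serves both criteria: [b] is 1 for (A) and the length of the step for (S1). *)
Lemma gap_prox_iter k t b : 0 <= t -> 0 <= b ->
  (gapPsi A lam sigma Y z x k <= (t ^+ 2 / (2 * sigma k) * b ^+ 2)%:E)%E ->
  normF (x k.+1 - q k) <= t * b.
Proof.
move=> t0 b0 h; have s0 := iter_sigma_gt0 k.
have := gap_prox lam_gt0 s0 (hq k) h; case: alm => _ _ _ /(_ k) <-.
have -> : 2 * sigma k * (t ^+ 2 / (2 * sigma k) * b ^+ 2) = (t * b) ^+ 2.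
  by field; rewrite gt_eqF.
by rewrite ler_pXn2r ?nnegrE ?mulr_ge0 ?(enorm_ge0 _).
Qed.

Lemma prox_eps k : normF (x k.+1 - q k) <= eps k.
Proof.
case: hA => eps0 h _; rewrite -[eps k]mulr1; apply: gap_prox_iter => //.
by rewrite expr1n mulr1.
Qed.

End Prox.

(** * Convergence and linear rate of the multipliers *)

Section Primal.
Variables (r kg : R).
Hypotheses (kg_ge0 : 0 <= kg) (EBGam : error_bound_dGam A lam I r kg)
  (x0_near : (dist (@dotF R (tdim I) 1) (x 0%N) O <= (r - alpha)%:E)%E)
  (hS1 : critS1 A lam sigma Y z x theta).

Lemma theta_cvg0 : theta @ \oo --> 0.
Proof.
case: hS1 => th0 _ /(nonneg_series_cauchy th0)[]; exact.
Qed.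

Lemma primal_rate k : theta k < 1 ->
  d (x k.+1) <= zeta kg (theta k) (sigma k) * d (x k).
Proof.
move=> th1; have [q hq] := iter_prox; case: hS1 => th0 h _.
have [eps0 _ _] := hA.
apply: (rdist_contract ipF sol_neq0 kg_ge0 EBGam x0_near iter_sigma_gt0 hq sum_eps_le
  (prox_eps hq) (th0 k) th1).
by apply: gap_prox_iter => //; exact: enorm_ge0.
Qed.

Lemma primal_cvg : exists2 xs, O xs & normF (x k - xs) @[k --> \oo] --> 0.
Proof.
have [q hq] := iter_prox.
case: (alm) => s0 nd sc _.
have d_cvg : forall e, 0 < e -> \forall k \near \oo, d (x k) < e.
  apply: (contract_cvg0 (c := fun k => zeta kg (theta k) (sigma k))
     (l := zeta_inf kg sigmaoo)).
  - by move=> k; exact: rdist_ge0.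
  - exact: (zeta_inf_lt1 s0 nd sc).
  - by apply: (zeta_cvg s0 nd sc) => //; exact: theta_cvg0.
  (* [theta k < 1] holds from some index on, which suffices for the limit. *)
  - near=> k; apply: primal_rate; near: k.
    exact: cvgr_lt theta_cvg0 _ ltr01.
have [xs xsx] := normF_complete (fejer_cauchy ipF sol_neq0 iter_sigma_gt0 hq
  (prox_eps hq) d_cvg (proj2 eps_tail)).
(* Vanishing distances place solutions arbitrarily near [xs], and the solution set is closed. *)
exists xs => //; apply: (subdiff_closed ipF (f := @Gam R p n A lam I)) => [y|e e0].
  exact: dGam_neq0.
have e2 : 0 < e / 2 by lra.
near \oo => k.
have h1 : d (x k) < e / 2 by near: k; exact: d_cvg.
have h2 : normF (x k - xs) < e / 2 by near: k; exact: cvgr_lt xsx _ e2.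
have dme : 0 < e / 2 - d (x k) by lra.
have [xb Oxb xbe] := rdist_approx (dot := @dotF R _ _) sol_neq0 (x k) dme.
exists xb => //; apply: (le_lt_trans (ler_enormB ipF _ _ (x k))).
by rewrite (enormBC ipF xs); move: h2 xbe; rewrite /normF; lra.
Unshelve. all: by end_near. Qed.

End Primal.

(** * Convergence of the dual iterates *)

Section Dual.
Variables (xs zs : 'cV[R]_(tdim I)).
Hypotheses (xsx : normF (x k - xs) @[k --> \oo] --> 0)
  (bzs : blam lam zs) (zxs : dotF zs xs = supp lam xs)
  (KKT : 0 = S (S^* xs) - e1 R I + zs).
Local Notation Ys := (S^* xs).
Local Notation w k := (Y k, z k, x k).

Lemma res_iter k : res k.+1 = (sigma k)^-1 *: (x k - x k.+1).
Proof.
case: alm => _ _ _ /(_ k) ->; rewrite subKr scalerA mulVf ?scale1r//.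
by rewrite gt_eqF// iter_sigma_gt0.
Qed.

Lemma normF_res k : normF (res k.+1) = (sigma k)^-1 * normF (x k.+1 - x k).
Proof.
rewrite res_iter /normF (enormZ ipF) (enormBC ipF) ger0_norm//.
by rewrite invr_ge0 ltW// iter_sigma_gt0.
Qed.

Lemma res_cvg0 : normF (res k.+1) @[k --> \oo] --> 0.
Proof.
have s0 := iter_sigma_gt0.
pose h k := (sigma 0%N)^-1 * (normF (x k.+1 - xs) + normF (x k - xs)).
apply: (@squeeze_cvgr _ _ _ _ (cst 0) h); last 2 first.
- exact: cvg_cst.
- rewrite -[X in _ --> X](mulr0 (sigma 0%N)^-1) -[X in _ * X]addr0; apply: cvgMr.
  by apply: cvgD => //; apply/(cvgr_shiftS (fun k => normF (x k - xs))).
apply: nearW => k; rewrite (enorm_ge0 _)/= normF_res; apply: ler_pM.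
- by rewrite invr_ge0 ltW.
- exact: enorm_ge0.
- by rewrite lef_pV2 ?posrE//; case: alm => _ nd _ _; exact: nd.
- by rewrite [normF (x k - xs)](enormBC ipF); exact: (ler_enormB ipF).
Qed.

(** [saddle_growth] at the iterate is added to the gap estimate against the feasible pair (Ys, zs).
    There remain <res, x k - xs> and the gap, the latter bounded through sigma k >= sigma 0. *)
Lemma sqr_dual_le k : normF (Y k.+1 - Ys) ^+ 2 <=
  2 * (normF (res k.+1) * normF (x k - xs)) + (sigma 0%N)^-1 * eps k ^+ 2.
Proof.
have s0 := iter_sigma_gt0; have [q hq] := iter_prox; have [_ /(_ k) gapk _] := hA.
have b := gap_blam lam_gt0 (s0 k) (hq k) gapk.
have := gap_feasible lam_gt0 (s0 k) (hq k) gapk (yz' := (Ys, zs)) bzs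
  (saddle_feasible KKT).
have := saddle_growth zxs KKT b.
have := cauchy_schwarz ipF (res k.+1) (x k - xs).
rewrite /aug /lagr (ipDr ipF (res k.+1) (x k)) (ipNr ipF) /= -/(normF _).
have : 0 <= sigma k / 2 * dotF (res k.+1) (res k.+1).
  by rewrite mulr_ge0 ?(ip_ge0 ipF)// divr_ge0// ltW.
have : eps k ^+ 2 / (2 * sigma k) <= 2^-1 * ((sigma 0%N)^-1 * eps k ^+ 2).
  rewrite invfM mulrCA ler_wpM2l// mulrC ler_wpM2r ?sqr_ge0// lef_pV2 ?posrE//.
  by case: alm => _ nd _ _; exact: nd.
rewrite (sqr_enorm ipF) /normF; lra.
Qed.

Lemma dual_cvg : normF (Y k - Ys) @[k --> \oo] --> 0.
Proof.
apply/(cvgr_shiftS (fun k => normF (Y k - Ys))).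
pose h k := Num.sqrt (2 * (normF (res k.+1) * normF (x k - xs))
                      + (sigma 0%N)^-1 * eps k ^+ 2).
apply: (@squeeze_cvgr _ _ _ _ (cst 0) h); last 2 first.
- exact: cvg_cst.
- rewrite -[X in _ --> X]sqrtr0; apply: continuous_cvg; first exact: sqrt_continuous.
  have -> : 0 = 2 * (0 * 0) + (sigma 0%N)^-1 * (0 * 0) :> R by rewrite !mulr0 addr0.
  apply: cvgD; apply: cvgMr; apply: cvgM => //; first exact: res_cvg0.
  + exact: (proj1 eps_tail).
  + exact: (proj1 eps_tail).
apply: nearW => k; rewrite (enorm_ge0 _)/= -[leLHS]ger0_norm ?(enorm_ge0 _)//.
by rewrite -sqrtr_sqr ler_wsqrtr// sqr_dual_le.
Qed.

(** The residual determines [z] from [Y]: z k.+1 - zs = res - S (Y k.+1 - Ys), with [S] bounded. *)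
Lemma dual_cvg_slack : normF (z k - zs) @[k --> \oo] --> 0.
Proof.
apply/(cvgr_shiftS (fun k => normF (z k - zs))); have [K K0 hK] := Sop_bounded A I.
pose h k := normF (res k.+1) + K * normF (Y k.+1 - Ys).
apply: (@squeeze_cvgr _ _ _ _ (cst 0) h); last 2 first.
- exact: cvg_cst.
- rewrite -[X in _ --> X]addr0 -[X in _ + X](mulr0 K).
  apply: cvgD; first exact: res_cvg0.
  by apply: cvgMr; apply/(cvgr_shiftS (fun k => normF (Y k - Ys))); exact: dual_cvg.
apply: nearW => k; rewrite (enorm_ge0 _)/=.
have -> : z k.+1 - zs = res k.+1 - S (Y k.+1 - Ys).
  have -> : zs = e1 R I - S Ys.
    by apply/eqP; rewrite -subr_eq0 opprB [_ + (_ - _)]addrC -KKT.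
  rewrite SopB; move: (S (Y k.+1)) (S Ys) => b a.
  by rewrite !opprB [RHS]addrC -(addrA b) subrKA addrCA.
apply: (le_trans (ler_enormD ipF _ _)); rewrite lerD2l (enormN ipF).
exact: hK.
Qed.

Lemma dist_zerosTL_le k : (dist (dotYZX p n I) (w k) (zerosTL A lam I)
  <= (normF (Y k - Ys) + normF (z k - zs) + normF (x k - xs))%:E)%E.
Proof.
apply: (le_trans (dist_le _ (saddle_zerosTL bzs zxs KKT))); rewrite lee_fin.
apply: (le_trans (enorm_dotX_le (dotX_ip ipF ipF) ipF _)).
by rewrite lerD2r; exact: (enorm_dotX_le ipF ipF).
Qed.

Lemma dist_zerosTL_ge k :
  ((enorm (dotYZ p n I) ((Y k, z k) - (Ys, zs)))%:E
   <= dist (dotYZX p n I) (w k) (zerosTL A lam I))%E.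
Proof.
apply: le_ereal_inf_tmp => _ [w' /(zerosTL_saddle bzs zxs KKT) w'E <-].
rewrite lee_fin ler_wsqrtr// /dotYZX [leRHS]/dotX /= w'E lerDl.
exact: (ip_ge0 ipF).
Qed.

(** * Error estimate under criterion (S2) *)

Section Residual.
Variable theta' : nat -> R.
Hypothesis hS2 : critS2 A lam sigma Y z x theta'.

(** A near-minimal subgradient of the subproblem, of size about theta' / sigma times the step, is
    paired with the residual, of size 1 / sigma times the step. *)
Lemma residual_TL k : TL A lam (w k.+1) !=set0 /\
  (dist (dotYZX p n I) 0 (TL A lam (w k.+1))
   <= ((1 + theta' k) / sigma k * normF (x k.+1 - x k))%:E)%E.
Proof.
have s0 := iter_sigma_gt0; have [q hq] := iter_prox; have [_ /(_ k) gapk _] := hA.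
have b := gap_blam lam_gt0 (s0 k) (hq k) gapk.
case: hS2 => _ /(_ k) hk _.
have near e : 0 < e -> exists2 v, TL A lam (w k.+1) v &
    enorm (dotYZX p n I) (0 - v)
      <= (1 + theta' k) / sigma k * normF (x k.+1 - x k) + e.
  move=> e0; have [|u hu ue] := @dist_ltP _ _ _ _ _
      (theta' k / sigma k * normF (x k.+1 - x k) + e) (le_lt_trans hk _).
    by rewrite lte_fin ltrDl.
  exists (u, res k.+1).
    have := subdiff_augLagr_TL lam_gt0 (s0 k) b hu.
    by case: (alm) => _ _ _ /(_ k) <-.
  apply: (le_trans (enorm_dotX_le (dotX_ip ipF ipF) ipF _)).
  rewrite /= !sub0r [X in _ + X](enormN ipF) -/(normF _) normF_res.
  move: ue; rewrite sub0r; lra.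
split; first by have [v hv _] := near _ ltr01; exists v.
apply/lee_addgt0Pr => e e0; have [v hv ve] := near _ e0.
by apply: (le_trans (dist_le _ hv)); rewrite -EFinD lee_fin.
Qed.

Lemma dual_rate rl kl k : 0 <= kl -> error_bound_TL A lam I rl kl ->
  (dist (dotYZX p n I) (w k.+1) (zerosTL A lam I) <= rl%:E)%E ->
  enorm (dotYZ p n I) ((Y k.+1, z k.+1) - (Ys, zs))
    <= zeta' kl (theta' k) (sigma k) * normF (x k.+1 - x k).
Proof.
move=> kl0 EB hd; have [TL0 hT] := residual_TL k.
rewrite -lee_fin; apply: (le_trans (dist_zerosTL_ge _)).
apply: (le_trans (EB _ TL0 hd)).
rewrite /zeta' -!mulrA EFinM lee_wpmul2l ?lee_fin//; apply: (le_trans hT).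
by rewrite lee_fin mulrA.
Qed.

End Residual.
End Dual.
End Iterates.
(** [theta k < 1] keeps the denominator of [zeta] positive and holds for all large k, as [theta] is
    summable. The error bound for [TL] acts within its radius [rl]: it covers every iterate once
    [rl] reaches a bound [R0] on their distances to the zeros, and the late iterates for any
    [rl]. *)
Theorem theorem12 (R : realType) (p n : nat) (A : 'M[R]_(p, n)) (lam : R)
    (I : {set 'I_p * 'I_p})
    (rankA : \rank A = n) (lam_gt0 : 0 < lam)
    (symI : symmetric_index I) (diagI : diag_index I)
    (sol_neq0 : sol_primal A lam I !=set0)
    (r kg : R) (r_gt0 : 0 < r) (kg_ge0 : 0 <= kg)
    (EBGam : error_bound_dGam A lam I r kg)
    (sigma eps theta : nat -> R) (sigmaoo : \bar R) (alpha : R)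
    (Y : nat -> 'M[R]_(p, n)) (z x : nat -> 'cV[R]_(tdim I))
    (x0_near : (dist (@dotF R (tdim I) 1) (x 0%N) (sol_primal A lam I)
                <= (r - alpha)%:E)%E)
    (alm : ialm A sigma sigmaoo Y z x)
    (hA : critA A lam sigma Y z x eps alpha)
    (hS1 : critS1 A lam sigma Y z x theta) :
  [/\ exists2 xs, sol_primal A lam I xs & x @ \oo --> xs,
      forall k, theta k < 1 ->
        (dist (@dotF R (tdim I) 1) (x k.+1) (sol_primal A lam I)
         <= (zeta kg (theta k) (sigma k))%:E
            * dist (@dotF R (tdim I) 1) (x k) (sol_primal A lam I))%E,
      zeta kg (theta k) (sigma k) @[k --> \oo] --> zeta_inf kg sigmaoo,
      zeta_inf kg sigmaoo < 1 &
      exists Ys zs,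
        [/\ sol_dual A lam I = [set (Ys, zs)],
            Y @ \oo --> Ys,
            z @ \oo --> zs &
            forall theta' : nat -> R, critS2 A lam sigma Y z x theta' ->
              let bound kl k :=
                enorm (dotYZ p n I) ((Y k.+1, z k.+1) - (Ys, zs))
                <= zeta' kl (theta' k) (sigma k) * normF (x k.+1 - x k) in
              (exists R0 : R, forall rl kl : R, 0 < rl -> R0 <= rl -> 0 <= kl ->
                 error_bound_TL A lam I rl kl -> forall k, bound kl k) /\
              (forall rl kl : R, 0 < rl -> 0 <= kl ->
                 error_bound_TL A lam I rl kl ->
                 [/\ forall k,
                       (dist (dotYZX p n I) (Y k.+1, z k.+1, x k.+1)
                          (zerosTL A lam I) <= rl%:E)%E -> bound kl k,
                     \forall k \near \oo, bound kl k &
                     zeta' kl (theta' k) (sigma k) @[k --> \oo]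
                       --> zeta'_inf kl sigmaoo])]].
Proof.
have ipF q m : inner_product (@dotF R q m) := dotF_ip q m.
have [xs Oxs xsx] :=
  primal_cvg lam_gt0 sol_neq0 alm hA kg_ge0 EBGam x0_near hS1.
case: (alm) => s0 nd sc _.
have [zs [bzs zxs KKT]] := (dGamP A lam_gt0 xs 0).1 Oxs.
have Yc := dual_cvg lam_gt0 sol_neq0 alm hA xsx bzs zxs KKT.
have zc := dual_cvg_slack lam_gt0 sol_neq0 alm hA xsx bzs zxs KKT.
split.
- by exists xs => //; exact: normF_cvg0.
- move=> k th1; rewrite !(distE sol_neq0) -EFinM lee_fin.
  exact: (primal_rate lam_gt0 sol_neq0 alm hA kg_ge0 EBGam x0_near hS1).
- by apply: (zeta_cvg s0 nd sc) => //; exact: (theta_cvg0 hS1).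
- exact: (zeta_inf_lt1 s0 nd sc).
exists (Sadj A xs), zs; split.
- exact: sol_dual_saddle.
- exact: normF_cvg0.
- exact: normF_cvg0.
move=> theta' hS2 /=.
pose b k := normF (Y k - Sadj A xs) + normF (z k - zs) + normF (x k - xs).
have b0 : b @ \oo --> 0.
  rewrite -[X in _ --> X]addr0 -[X in _ --> X + _]addr0.
  by apply: cvgD => //; exact: cvgD.
have dist_b := dist_zerosTL_le Y z x bzs zxs KKT.
have rate := dual_rate lam_gt0 sol_neq0 alm hA bzs zxs KKT hS2.
split.
  (* [b] converges, hence is bounded; a radius above this bound covers all iterates. *)
  have [R0 hR0] : exists R0, forall k, b k <= R0.
    have /cvg_seq_bounded[M [_ hM]] : cvgn b by apply/cvg_ex; exists 0.
    exists (M + 1) => k; apply: (le_trans (ler_norm _)).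
    by apply: hM => //; rewrite ltrDl.
  exists R0 => rl kl _ R0rl kl0 EB k; apply: (rate _ _ k kl0 EB).
  by rewrite (le_trans (dist_b _))// lee_fin (le_trans (hR0 _)).
move=> rl kl rl0 kl0 EB; split.
- by move=> k; exact: rate kl0 EB.
(* [b] tends to 0, so it falls below any given radius. *)
- near=> k; apply: (rate _ _ k kl0 EB).
  rewrite (le_trans (dist_b _))// lee_fin; apply: ltW; near: k.
  exact: cvgr_lt ((cvgr_shiftS b 0).2 b0) _ rl0.
- by apply: (zeta'_cvg s0 nd sc); case: hS2.
Unshelve. all: by end_near. Qed.
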